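(* Let $p_1,p_2,q_1,q_2\in\mathbb{R}$ satisfy $|p_1|\ne|p_2|$, $|q_1|\ne|q_2|$ and $\max\{p_1^2,p_2^2\}+\max\{q_1^2,q_2^2\}<1$. Then the oriented volume $\mathcal{V}$ of the flexible octahedron in $\mathbb{S}^3$ given by $$\begin{aligned} \mathbf{a}_1&=\Bigl(\tfrac{p_1}{\cos\theta},\delta_1\sqrt{1-\tfrac{p_1^2}{\cos^2\theta}},0,0\Bigr),& \mathbf{b}_1&=\Bigl(\tfrac{p_2}{\cos\theta},\delta_2\sqrt{1-\tfrac{p_2^2}{\cos^2\theta}},0,0\Bigr),\\ \mathbf{a}_2&=\Bigl(0,0,\tfrac{q_1}{\sin\theta},\varepsilon_1\sqrt{1-\tfrac{q_1^2}{\sin^2\theta}}\Bigr),& \mathbf{b}_2&=\Bigl(0,0,\tfrac{q_2}{\sin\theta},\varepsilon_2\sqrt{1-\tfrac{q_2^2}{\sin^2\theta}}\Bigr),\\ \mathbf{a}_3&=(\cos\theta,0,\sin\theta,0),&\mathbf{b}_3&=(\cos\theta,0,-\sin\theta,0) \end{aligned}$$ is nonconstant on any arbitrarily small segment of the configuration curve $\Gamma$.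
   Context: **Setting.** $\mathbb{S}^3$ is the unit sphere in $\mathbb{E}^4$. In the formulae, $\delta_1,\delta_2,\varepsilon_1,\varepsilon_2\in\{-1,1\}$ and $\theta\in[\theta_{\min},\theta_{\max}]$, $\theta_{\min}=\arcsin(\max\{|q_1|,|q_2|\})$, $\theta_{\max}=\arccos(\max\{|p_1|,|p_2|\})$. An octahedron with vertices $\mathbf{a}_i,\mathbf{b}_i$ ($i=1,2,3$) has as edges all pairs of vertices except $\{\mathbf{a}_i,\mathbf{b}_i\}$ and 8 faces $\mathbf{u}_1\mathbf{u}_2\mathbf{u}_3$, $\mathbf{u}_i\in\{\mathbf{a}_i,\mathbf{b}_i\}$; it is oriented so that $\mathbf{a}_1\mathbf{a}_2\mathbf{a}_3$ is positively oriented. **Configuration curve.** $\Gamma$ is the set of all octahedra given by the formulae above, for all $\theta\in[\theta_{\min},\theta_{\max}]$ and all signs $\delta_1,\delta_2,\varepsilon_1,\varepsilon_2$, considered up to rotations of $\mathbb{S}^3$ (equivalently, it is the corresponding curve in $(\mathbb{RP}^1)^{12}$ whose coordinates are the tangents of the halves of the oriented dihedral angles at the 12 edges). Simultaneous reversal of all four signs is realized by a rotation. $\Gamma$ is a disjoint union of two topological circles: if, say, $|p_1|<|p_2|$ and $|q_1|<|q_2|$, they correspond to $\delta_1\varepsilon_1=1$ and $\delta_1\varepsilon_1=-1$, and along each of them $\delta_2$ changes when $\theta=\theta_{\max}$ and $\varepsilon_2$ changes when $\theta=\theta_{\min}$. A segment of $\Gamma$ is an arc of $\Gamma$ of positive length.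 The oriented volume is regarded as a function $\mathcal{V}\colon\Gamma\to\mathbb{R}/2\pi^2\mathbb{Z}$. **Oriented volume.** For a spherical tetrahedron with linearly independent vertices, $V_{\mathrm{or}}(\mathbf{c}_1,\mathbf{c}_2,\mathbf{c}_3,\mathbf{c}_4)=\operatorname{sgn}\det(\mathbf{c}_1,\mathbf{c}_2,\mathbf{c}_3,\mathbf{c}_4)$ times its volume. The (generalized) oriented volume of an octahedron is the sum $\sum V_{\mathrm{or}}(\mathbf{o},\mathbf{v}_0,\mathbf{v}_1,\mathbf{v}_2)$ over all positively oriented faces $\mathbf{v}_0\mathbf{v}_1\mathbf{v}_2$, where $\mathbf{o}\in\mathbb{S}^3$ is any point for which all these tetrahedra are non-degenerate; it is well defined as an element of $\mathbb{R}/2\pi^2\mathbb{Z}$. *)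

(* Defs.v *)
From HB Require Import structures.
From mathcomp Require Import all_boot all_order all_algebra.
From mathcomp Require Import all_classical all_reals all_analysis.
Import Order.TTheory GRing.Theory Num.Theory.
Import numFieldNormedType.Exports.

Set Implicit Arguments.
Unset Strict Implicit.
Unset Printing Implicit Defensive.

Local Open Scope classical_set_scope.
Local Open Scope ring_scope.
Local Open Scope quotient_scope.

Definition vec4 (R : realType) (x y z w : R) : 'rV[R]_4 :=
  \row_(j < 4) [:: x; y; z; w]`_j.

Definition sphere3 (R : realType) : set 'rV[R]_4 :=
  [set x | \sum_(j < 4) x ord0 j ^+ 2 = 1].

Definition lebesgue_measure4 (R : realType) : set (R * R * R * R) -> \bar R :=
  (((@lebesgue_measure R \x @lebesgue_measure R) \x @lebesgue_measure R)
     \x @lebesgue_measure R)%E.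

(* The 3-dimensional volume on S^3 as the cone measure: with
   cone A = {r a | 0 <= r <= 1, a in A}, integration in polar coordinates gives
   Leb^4 (cone A) = (\int_0^1 r^3 dr) vol A = vol A / 4. *)
Definition sphere3_volume (R : realType) (A : set 'rV[R]_4) : R :=
  4 * fine (lebesgue_measure4
    [set x : R * R * R * R | exists r : R, exists a : 'rV[R]_4,
       [/\ 0 <= r <= 1, A a & vec4 x.1.1.1 x.1.1.2 x.1.2 x.2 = r *: a]]).

(* The vertices of a tetrahedron are the rows of a matrix. *)
Definition spherical_tetrahedron (R : realType) (C : 'M[R]_4) :
    set 'rV[R]_4 :=
  [set x | sphere3 x /\
     exists t : 'rV[R]_4, (forall i, 0 <= t ord0 i) /\ x = t *m C].

Definition tetrahedron_oriented_volume (R : realType) (C : 'M[R]_4) : R :=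
  Num.sg (\det C) * sphere3_volume (spherical_tetrahedron C).

(* Row i of the first (second) matrix is the vertex a_(i+1) (b_(i+1)). *)
Definition octahedron (R : realType) : Type :=
  ('M[R]_(3, 4) * 'M[R]_(3, 4))%type.

(* The vertices of the face u_1 u_2 u_3, where u_(i+1) is b_(i+1) if s i and
   a_(i+1) otherwise, listed in a positive order: two adjacent faces u_1 u_2 u_3
   differ in one vertex and have opposite orientations, and a_1 a_2 a_3 is
   positive. *)
Definition positive_face (R : realType) (P : octahedron R)
    (s : {ffun 'I_3 -> bool}) : 'M[R]_(3, 4) :=
  let F := \matrix_(i < 3) row i (if s i then P.2 else P.1) in
  if odd #|[set i | s i]%SET| then xrow 0 1 F else F.

Definition face_cone (R : realType) (P : octahedron R) (o : 'rV[R]_4)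
    (s : {ffun 'I_3 -> bool}) : 'M[R]_4 :=
  col_mx o (positive_face P s).

Definition admissible_apex (R : realType) (P : octahedron R) :
    set 'rV[R]_4 :=
  [set o | sphere3 o /\ forall s, face_cone P o s \in unitmx].

Definition volume_periods (R : realType) : {pred R} :=
  [pred x | x / (2 * pi ^+ 2) \is a Num.int].

Lemma volume_periods_zmod_closed (R : realType) :
  zmod_closed (@volume_periods R).
Proof.
split=> [|x y]; rewrite !inE ?mul0r ?rpred0 // => hx hy.
by rewrite mulrBl rpredB.
Qed.

HB.instance Definition _ (R : realType) :=
  GRing.isZmodClosed.Build R (@volume_periods R) (volume_periods_zmod_closed R).

(* R / 2 pi^2 Z *)
Definition volume_class (R : realType) : zmodType :=
  {ideal_quot @volume_periods R}.

(* The class does not depend on the choice of the admissible apex. *)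
Definition octahedron_oriented_volume (R : realType) (P : octahedron R) :
    volume_class R :=
  let o := get (admissible_apex P) in
  \pi_({ideal_quot @volume_periods R})
    (\sum_(s : {ffun 'I_3 -> bool})
       tetrahedron_oriented_volume (face_cone P o s)).

Definition rotation (R : realType) (Q : 'M[R]_4) : Prop :=
  Q *m Q^T = 1%:M /\ \det Q = 1.

Definition congruent (R : realType) : rel (octahedron R) :=
  fun P P' => `[< exists Q : 'M[R]_4,
    rotation Q /\ P' = (P.1 *m Q, P.2 *m Q) >].

Lemma congruent_refl (R : realType) : reflexive (@congruent R).
Proof.
move=> [A B]; apply/asboolP; exists 1%:M; split; last by rewrite !mulmx1.
by split; rewrite ?trmx1 ?mulmx1 ?det1.
Qed.

Lemma congruent_sym (R : realType) : symmetric (@congruent R).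
Proof.
suff h P P' : @congruent R P P' -> congruent P' P.
  by move=> P P'; apply/idP/idP; exact: h.
move=> /asboolP[Q [[QQ dQ] ->]]; apply/asboolP; exists Q^T; split.
  by split; rewrite ?trmxK ?det_tr // (mulmx1C QQ).
by case: P => A B /=; rewrite -!mulmxA QQ !mulmx1.
Qed.

Lemma congruent_trans (R : realType) : transitive (@congruent R).
Proof.
move=> P2 P1 P3 /asboolP[Q [[QQ dQ] ->]] /asboolP[S [[SS dS] ->]].
apply/asboolP; exists (Q *m S); split; last by rewrite /= !mulmxA.
split; last by rewrite det_mulmx dQ dS mulr1.
by rewrite trmx_mul mulmxA -(mulmxA Q) SS mulmx1.
Qed.

Canonical congruent_equiv (R : realType) : equiv_rel (octahedron R) :=
  EquivRel (@congruent R) (@congruent_refl R) (@congruent_sym R)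
    (@congruent_trans R).

(* Octahedra up to rotations, with the quotient topology. *)
Definition octahedron_class (R : realType) :=
  quotient_topology {eq_quot (congruent_equiv R)}.

Definition class_oriented_volume (R : realType) (x : octahedron_class R) :
    volume_class R :=
  octahedron_oriented_volume (repr x).

Definition flexible_octahedron (R : realType)
    (p1 p2 q1 q2 theta d1 d2 e1 e2 : R) : octahedron R :=
  let c := cos theta in
  let s := sin theta in
  let a := [:: vec4 (p1 / c) (d1 * Num.sqrt (1 - p1 ^+ 2 / c ^+ 2)) 0 0;
               vec4 0 0 (q1 / s) (e1 * Num.sqrt (1 - q1 ^+ 2 / s ^+ 2));
               vec4 c 0 s 0] in
  let b := [:: vec4 (p2 / c) (d2 * Num.sqrt (1 - p2 ^+ 2 / c ^+ 2)) 0 0;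
               vec4 0 0 (q2 / s) (e2 * Num.sqrt (1 - q2 ^+ 2 / s ^+ 2));
               vec4 c 0 (- s) 0] in
  (\matrix_(i < 3) a`_i, \matrix_(i < 3) b`_i).

Definition is_sign (R : realType) (x : R) : Prop := x = 1 \/ x = -1.

Definition configuration_curve (R : realType) (p1 p2 q1 q2 : R) :
    set (octahedron_class R) :=
  [set x | exists theta d1 d2 e1 e2 : R,
     [/\ asin (Num.max `|q1| `|q2|) <= theta <= acos (Num.max `|p1| `|p2|),
         is_sign d1 /\ is_sign d2, is_sign e1 /\ is_sign e2 &
         x = \pi_(octahedron_class R)
               (flexible_octahedron p1 p2 q1 q2 theta d1 d2 e1 e2)]].

(* The quotient of octahedra by the compact group SO(4) is Hausdorff, so gamma is
   a homeomorphism of [0, 1] onto S. *)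
Definition is_segment (R : realType) (G S : set (octahedron_class R)) : Prop :=
  S `<=` G /\ exists gamma : R -> octahedron_class R,
    [/\ {within `[0, 1], continuous gamma},
        {in `[0, 1] &, injective gamma} &
        S = gamma @` `[0, 1]].

(* Main.v *)
(* Modulo the volume of the sphere, the boundary of a 4-simplex has oriented volume 0;
   hence the volume of the octahedron is the alternating sum of the oriented volumes of
   the four tetrahedra [a_3 b_3 u_1 u_2] that share a diagonal. The symmetry [diag(1, 1, -1, -1)] cuts a region
   bounded by three great spheres into two congruent copies of such a tetrahedron, so
   Girard's formula expresses its volume through arccosines of algebraic functions of
   theta. The derivative of the sum in theta is algebraic; eliminating the square
   roots shows that its zeros satisfy a nonzero polynomial equation in [cos theta ^ 2].
   Hence for fixed signs each value of the volume modulo the countable group of periods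
   is taken at countably many angles only, whereas a segment is uncountable. *)
Require Import Defs.
From HB Require Import structures.
From mathcomp Require Import all_boot all_order all_algebra.
From mathcomp Require Import all_classical all_reals all_analysis.
From mathcomp Require Import perm measurable_realfun ring lra.
Import Order.TTheory GRing.Theory Num.Theory.
Import numFieldNormedType.Exports.

Local Open Scope classical_set_scope.
Local Open Scope ring_scope.

Local Notation leb := lebesgue_measure.

(** * Orthogonal invariance of Lebesgue measure *)

(** Every volume is computed as a fraction of the measure of the unit ball, which stays symbolic.
    Angles enter because the measure of a lune is additive and bounded in its angle, hence linear.
    Two period groups result: the multiples of [2 * pi ^+ 2] from the quotient in the definition,
    and the multiples of the total volume [sphere_total] that the five-term relation produces; their
    sum is countable, so the possible levels remain countable. Relations between cones are not
    obtained by dissection. They are identities between indicator functions that hold off finitely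
    many hyperplanes, and are integrated over the ball. The orientation signs vary along the curve,
    so the equation for critical angles has to be nontrivial for every choice of signs. The
    elimination squares all signs away, and one polynomial serves all cases. At the larger of
    [p1 ^+ 2], [p2 ^+ 2] its value is a square with the difference of these two numbers and the
    difference of the two numbers [sqrt (1 - q ^+ 2)] among its factors: this is where
    [|p1| != |p2|] and [|q1| != |q2|] enter. *)

Definition preserves {d} {T : measurableType d} {R : realType}
    (mu : set T -> \bar R) (f : T -> T) : Prop :=
  measurable_fun setT f /\ forall A, measurable A -> mu (f @^-1` A) = mu A.

Lemma preserves_comp {d} {T : measurableType d} {R : realType}
    (mu : set T -> \bar R) (f g : T -> T) :
  preserves mu f -> preserves mu g -> preserves mu (f \o g).
Proof.
move=> [mf hf] [mg hg]; split; first exact: measurableT_comp.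
move=> A mA; rewrite comp_preimage hg ?hf// -[X in measurable X]setTI.
exact: mf.
Qed.

(** Lebesgue measure is determined by half-open intervals. When [b] holds, the preimage of such an
    interval is half-open at the other end, with the same length. *)
Lemma lebesgue_measure_affine {R : realType} (b : bool) (c : R) (A : set R) :
  measurable A ->
  lebesgue_measure ((fun t : R => (-1) ^+ b * t + c) @^-1` A) =
  lebesgue_measure A.
Proof.
move=> mA.
pose f := (fun t : measurableTypeR R => ((-1) ^+ b * t + c) : measurableTypeR R).
have mf : measurable_fun setT f.
  by apply: measurable_funD => //; apply: measurable_funM.
pose F : {mfun measurableTypeR R >-> measurableTypeR R} := mfun_Sub (mem_set mf).
rewrite [RHS](@lebesgue_measure_unique _ (pushforward lebesgue_measure F)) //.
move=> X [[x y] _ <-] /=; rewrite /pushforward.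
have -> : F @^-1` `]x, y] =
    [set` if b then `[c - y, c - x[ else `]x - c, y - c] : interval R].
  apply/seteqP; rewrite /F /= /f; case: (b) => /=.
    split => t /=; rewrite !in_itv /= expr1 mulN1r => /andP[h1 h2];
    apply/andP; split; lra.
  split => t /=; rewrite !in_itv /= expr0 mul1r => /andP[h1 h2];
  apply/andP; split; lra.
rewrite lebesgue_measure_itv; case: (b) => /=; rewrite lebesgue_measure_itv /= !lte_fin.
- rewrite (_ : (c - y < c - x) = (x < y)); last by apply/idP/idP; lra.
  by case: ifP => // _; rewrite !EFinN -!EFinD; congr (_%:E); lra.
- rewrite (_ : (x - c < y - c) = (x < y)); last by apply/idP/idP; lra.
  by case: ifP => // _; rewrite !EFinN -!EFinD; congr (_%:E); lra.
Qed.

Section shears.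
Context {d1 d2} {T1 : measurableType d1} {T2 : measurableType d2} {R : realType}.
Variables (m1 : {sigma_finite_measure set T1 -> \bar R})
          (m2 : {sigma_finite_measure set T2 -> \bar R}).

(** The product measure integrates the measures of sections, and a section of the preimage is the
    preimage of a section under [g x]. *)
Lemma preserves_shear1 (g : T1 -> T2 -> T2) :
  measurable_fun setT (fun z : T1 * T2 => g z.1 z.2) ->
  (forall x, preserves m2 (g x)) ->
  preserves (m1 \x m2)%E (fun z => (z.1, g z.1 z.2)).
Proof.
move=> mg hg; split; first by apply: measurable_fun_pair.
move=> A mA; rewrite /product_measure1; apply: eq_integral => x _ /=.
rewrite -[RHS](hg x).2; last exact: measurable_xsection.
congr (m2 _); apply/seteqP; split => y /=; rewrite /xsection /= !inE //=.
Qed.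

Lemma preserves_shear2 (g : T2 -> T1 -> T1) :
  measurable_fun setT (fun z : T1 * T2 => g z.2 z.1) ->
  (forall x, preserves m1 (g x)) ->
  preserves (m1 \x m2)%E (fun z => (g z.2 z.1, z.2)).
Proof.
move=> mg hg.
have mf : measurable_fun setT (fun z : T1 * T2 => (g z.2 z.1, z.2)).
  by apply: measurable_fun_pair.
split => // A mA.
(* The product is defined through sections over the first factor, whereas this shear acts on
   sections over the second one; uniqueness of the product measure allows the exchange. *)
have E X : measurable X -> (m1 \x m2)%E X = (m1 \x^ m2)%E X.
  by apply: product_measure_unique => // B C mB mC/=; rewrite product_measure2E.
rewrite !E//; last by rewrite -[X in measurable X]setTI; exact: mf.
rewrite /product_measure2; apply: eq_integral => x _ /=.
rewrite -[RHS](hg x).2; last exact: measurable_ysection.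
congr (m1 _); apply/seteqP; split => y /=; rewrite /ysection /= !inE //=.
Qed.
End shears.

Lemma sigma_finite_product {d1 d2} {T1 : measurableType d1}
    {T2 : measurableType d2} {R : realType}
    (m1 : {sigma_finite_measure set T1 -> \bar R})
    (m2 : {sigma_finite_measure set T2 -> \bar R}) :
  sigma_finite setT (m1 \x m2)%E.
Proof.
(* Both exhaustions are increasing, so a point of [F i] times [G j] lies in the diagonal product of
   index [maxn i j]. *)
have /sigma_finiteP[F [UF ndF foo]] := sigma_finiteT m1.
have /sigma_finiteP[G [UG ndG goo]] := sigma_finiteT m2.
exists (fun n => F n `*` G n) => [|n]; last first.
  have [mF oF] := foo n; have [mG oG] := goo n.
  by split; [exact: measurableX|rewrite product_measure1E// lte_mul_pinfty// ge0_fin_numE].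
apply/esym; rewrite -subTset => -[x y] _.
have : [set: T1] x by []. rewrite UF => -[i _ Fix].
have : [set: T2] y by []. rewrite UG => -[j _ Gjy].
exists (maxn i j) => //; split => /=.
  by move: x Fix; exact/subsetPset/ndF/leq_maxl.
by move: y Gjy; exact/subsetPset/ndG/leq_maxr.
Qed.

(** Each partial product is named so that a sigma-finiteness instance is attached before the next
    factor is added; the last one, [leb4], is convertible to [lebesgue_measure4]. *)
Definition leb2 (R : realType) : set (measurableTypeR R * measurableTypeR R)%type -> \bar R :=
  (@leb R \x @leb R)%E.
HB.instance Definition _ (R : realType) := Measure.on (@leb2 R).
HB.instance Definition _ (R : realType) :=
  Measure_isSigmaFinite.Build _ _ _ (@leb2 R) (sigma_finite_product (@leb R) (@leb R)).

Definition leb3 (R : realType) :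
    set (measurableTypeR R * measurableTypeR R * measurableTypeR R)%type -> \bar R :=
  (leb2 R \x @leb R)%E.
HB.instance Definition _ (R : realType) := Measure.on (@leb3 R).
HB.instance Definition _ (R : realType) :=
  Measure_isSigmaFinite.Build _ _ _ (@leb3 R) (sigma_finite_product (leb2 R) (@leb R)).

Definition leb4 (R : realType) : set (measurableTypeR R * measurableTypeR R *
    measurableTypeR R * measurableTypeR R)%type -> \bar R := (leb3 R \x @leb R)%E.
HB.instance Definition _ (R : realType) := Measure.on (@leb4 R).

Lemma preserves_affine {R : realType} (b : bool) (c : R) :
  preserves (@lebesgue_measure R) (fun t => (-1) ^+ b * t + c).
Proof.
split; last by move=> A mA; exact: lebesgue_measure_affine.
by apply: measurable_funD => //; apply: measurable_funM.
Qed.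

Lemma preserves_translation3 {R : realType} (a b c : R) :
  preserves (leb3 R)
    (fun z : R * R * R => (z.1.1 + a, z.1.2 + b, z.2 + c)).
Proof.
have pt (t : R) : preserves (@lebesgue_measure R) (fun x => x + t).
  have -> : (fun x : R => x + t) = (fun x => (-1) ^+ false * x + t).
    by apply/funext => x; rewrite expr0 mul1r.
  exact: preserves_affine.
have p2 : preserves (leb2 R)
    (fun z : R * R => (z.1 + a, z.2 + b)).
  apply: (@preserves_comp _ _ _ _ (fun z : R * R => (z.1, z.2 + b))
                                  (fun z : R * R => (z.1 + a, z.2))).
    apply: (preserves_shear1 leb leb (fun _ y => y + b)) => [|_]; last exact: pt.
    by apply: measurable_funD => //; exact: measurable_snd.
  apply: (preserves_shear2 leb leb (fun _ y => y + a)) => [|_]; last exact: pt.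
  by apply: measurable_funD => //; exact: measurable_fst.
apply: (@preserves_comp _ _ _ _ (fun z : R * R * R => (z.1, z.2 + c))
          (fun z : R * R * R => (z.1.1 + a, z.1.2 + b, z.2))).
  apply: (preserves_shear1 (leb2 R) leb (fun _ y => y + c)) => [|_]; last exact: pt.
  by apply: measurable_funD => //; exact: measurable_snd.
apply: (preserves_shear2 (leb2 R) leb (fun _ (y : R * R) => (y.1 + a, y.2 + b))) => [|_//].
by apply: (@measurableT_comp _ _ _ _ _ _ _ _ fst p2.1); exact: measurable_fst.
Qed.

Definition coord4 {R : realType} (x : R * R * R * R) : 'rV[R]_4 :=
  vec4 x.1.1.1 x.1.1.2 x.1.2 x.2.

Definition uncoord4 {R : realType} (v : 'rV[R]_4) : R * R * R * R :=
  (v 0 0, v 0 1, v 0 2%:R, v 0 3%:R).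

Lemma coord4K {R : realType} : cancel (@coord4 R) uncoord4.
Proof. by move=> [[[a b] c] d]; rewrite /uncoord4 !mxE. Qed.

Lemma sum_I4 (V : zmodType) (F : 'I_4 -> V) :
  \sum_i F i = F 0 + F 1 + F 2%:R + F 3%:R.
Proof.
rewrite !big_ord_recl big_ord0 addr0 !addrA.
by congr (F _ + F _ + F _ + F _); apply/val_inj.
Qed.

Lemma forall_I4 (P : 'I_4 -> Prop) : P 0 -> P 1 -> P 2%:R -> P 3%:R -> forall i, P i.
Proof.
move=> P0 P1 P2 P3 [[|[|[|[|//]]]] h].
- by rewrite (_ : Ordinal h = 0) //; exact/val_inj.
- by rewrite (_ : Ordinal h = 1) //; exact/val_inj.
- by rewrite (_ : Ordinal h = 2%:R) //; exact/val_inj.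
- by rewrite (_ : Ordinal h = 3%:R) //; exact/val_inj.
Qed.

Lemma uncoord4K {R : realType} : cancel (@uncoord4 R) coord4.
Proof.
by move=> v; apply/rowP; apply: forall_I4; rewrite !mxE.
Qed.

(* A reflection in a hyperplane whose normal [n] has a nonzero last coordinate is
   conjugate, by the shear moving [n] to the last axis, to a map changing only the
   last coordinate. *)
Lemma preserves_reflection_last {R : realType} (n1 n2 n3 n4 f1 f2 f3 f4 : R) :
  n4 != 0 -> f1 * n1 + f2 * n2 + f3 * n3 + f4 * n4 = 2 ->
  preserves (leb4 R)
    (fun x => let t := x.1.1.1 * f1 + x.1.1.2 * f2 + x.1.2 * f3 + x.2 * f4 in
       (x.1.1.1 - t * n1, x.1.1.2 - t * n2, x.1.2 - t * n3, x.2 - t * n4)).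
Proof.
move=> n40 fn.
pose S (k : R) (x : R * R * R * R) :=
  (x.1.1.1 + x.2 * (k * n1), x.1.1.2 + x.2 * (k * n2), x.1.2 + x.2 * (k * n3), x.2).
(* The conjugate of the reflection by the shear. Its slope in the last coordinate is [1 - 2 = -1],
   where [2] is the assumed value of the functional [f] at [n]. *)
pose K (x : R * R * R * R) :=
  (x.1, (-1) ^+ true * x.2 + (- n4) * (f1 * x.1.1.1 + f2 * x.1.1.2 + f3 * x.1.2)).
pose T : Type := (measurableTypeR R * measurableTypeR R * measurableTypeR R * measurableTypeR R)%type.
have m1 : measurable_fun setT (fun x : T => x.1.1.1).
  by do 2! apply: measurableT_comp => //.
have m2 : measurable_fun setT (fun x : T => x.1.1.2).
  by do 2! apply: measurableT_comp => //.
have m3 : measurable_fun setT (fun x : T => x.1.2).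
  by apply: measurableT_comp.
have m4 : measurable_fun setT (fun x : T => x.2) by exact: measurable_snd.
have pS k : preserves (leb4 R) (S k).
  apply: (preserves_shear2 (leb3 R) leb (fun t (y : R * R * R) =>
     (y.1.1 + t * (k * n1), y.1.2 + t * (k * n2), y.2 + t * (k * n3)))) => [|t].
    by repeat apply: measurable_fun_pair; apply: measurable_funD => //;
       apply: measurable_funM.
  exact: preserves_translation3.
have pK : preserves (leb4 R) K.
  apply: (preserves_shear1 (leb3 R) leb (fun (y : R * R * R) t => (-1) ^+ true * t
     + (- n4) * (f1 * y.1.1 + f2 * y.1.2 + f3 * y.2))) => [|y].
    apply: measurable_funD; apply: measurable_funM => //.
    by repeat apply: measurable_funD; apply: measurable_funM.
  exact: preserves_affine.
rewrite (_ : (fun x => _) = S n4^-1 \o (K \o S (- n4^-1))).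
  by apply: preserves_comp => //; apply: preserves_comp.
apply/funext => -[[[x1 x2] x3] x4]; rewrite /S /K /= expr1.
have -> : f4 = (2 - f1 * n1 - f2 * n2 - f3 * n3) / n4 by rewrite -fn; field.
by congr (_, _, _, _); field.
Qed.

(** * Dot products, reflections and orthogonal matrices *)

Definition dotv {R : comNzRingType} {n : nat} (u v : 'rV[R]_n) : R := (u *m v^T) 0 0.

Lemma dotvE {R : comNzRingType} {n} (u v : 'rV[R]_n) :
  dotv u v = \sum_j u 0 j * v 0 j.
Proof. by rewrite /dotv mxE; apply: eq_bigr => j _; rewrite mxE. Qed.

Lemma dotvC {R : comNzRingType} {n} (u v : 'rV[R]_n) : dotv u v = dotv v u.
Proof. by rewrite !dotvE; apply: eq_bigr => j _; rewrite mulrC. Qed.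

Lemma dotvDl {R : comNzRingType} {n} (u v w : 'rV[R]_n) :
  dotv (u + v) w = dotv u w + dotv v w.
Proof. by rewrite /dotv mulmxDl mxE. Qed.

Lemma dotvZl {R : comNzRingType} {n} (a : R) (u w : 'rV[R]_n) :
  dotv (a *: u) w = a * dotv u w.
Proof. by rewrite /dotv -scalemxAl mxE. Qed.

Lemma dotvBl {R : comNzRingType} {n} (u v w : 'rV[R]_n) :
  dotv (u - v) w = dotv u w - dotv v w.
Proof. by rewrite dotvDl -scaleN1r dotvZl mulN1r. Qed.

Lemma dotvDr {R : comNzRingType} {n} (u v w : 'rV[R]_n) :
  dotv w (u + v) = dotv w u + dotv w v.
Proof. by rewrite dotvC dotvDl !(dotvC w). Qed.

Lemma dotvZr {R : comNzRingType} {n} (a : R) (u w : 'rV[R]_n) :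
  dotv w (a *: u) = a * dotv w u.
Proof. by rewrite dotvC dotvZl !(dotvC w). Qed.

Lemma dotvBr {R : comNzRingType} {n} (u v w : 'rV[R]_n) :
  dotv w (u - v) = dotv w u - dotv w v.
Proof. by rewrite dotvC dotvBl !(dotvC w). Qed.

Lemma dotv_mulmx {R : comNzRingType} {n} (u v : 'rV[R]_n) (Q : 'M[R]_n) :
  dotv (u *m Q) v = dotv u (v *m Q^T).
Proof. by rewrite /dotv trmx_mul trmxK mulmxA. Qed.

Lemma mulmx_dotv {R : comNzRingType} {n} (x u v : 'rV[R]_n) :
  x *m (u^T *m v) = dotv x u *: v.
Proof. by rewrite mulmxA [x *m _]mx11_scalar mul_scalar_mx. Qed.

Lemma dotv_delta {R : comNzRingType} {n} (u : 'rV[R]_n) i :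
  dotv u (delta_mx 0 i) = u 0 i.
Proof.
rewrite dotvE (bigD1 i) //= big1 ?mxE ?eqxx ?mulr1 ?addr0 //.
by move=> j ji; rewrite mxE (negbTE ji) andbF mulr0.
Qed.

Lemma dotv_row {R : comNzRingType} {m p n} (A : 'M[R]_(m, n)) (B : 'M[R]_(p, n)) i j :
  dotv (row i A) (row j B) = (A *m B^T) i j.
Proof. by rewrite dotvE mxE; apply: eq_bigr => k _; rewrite !mxE. Qed.

Lemma dotv_ge0 {R : realDomainType} {n} (u : 'rV[R]_n) : 0 <= dotv u u.
Proof. by rewrite dotvE; apply: sumr_ge0 => j _; rewrite -expr2 sqr_ge0. Qed.

Lemma dotv_eq0 {R : realDomainType} {n} (u : 'rV[R]_n) : (dotv u u == 0) = (u == 0).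
Proof.
apply/idP/eqP => [|->]; last by rewrite dotvE big1 // => j _; rewrite mxE mul0r.
rewrite dotvE psumr_eq0 => [/allP h|j _]; last by rewrite -expr2 sqr_ge0.
apply/rowP => j; rewrite mxE; apply/eqP.
by have := h j (mem_index_enum _); rewrite /= mulf_eq0 orbb.
Qed.

Definition reflection {R : realFieldType} {n : nat} (v : 'rV[R]_n) : 'M[R]_n :=
  1%:M - (2 / dotv v v) *: (v^T *m v).

Lemma mulmx_reflection {R : realFieldType} {n} (v x : 'rV[R]_n) :
  x *m reflection v = x - (2 / dotv v v * dotv x v) *: v.
Proof. by rewrite mulmxBr mulmx1 -scalemxAr mulmx_dotv scalerA. Qed.

Lemma reflection_tr {R : realFieldType} {n} (v : 'rV[R]_n) :
  (reflection v)^T = reflection v.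
Proof. by rewrite /reflection linearB linearZ /= trmx_mul trmxK trmx1. Qed.

Lemma eq_mulmx_row {R : comNzRingType} {m n} (A B : 'M[R]_(m, n)) :
  (forall x : 'rV_m, x *m A = x *m B) -> A = B.
Proof. by move=> h; apply/row_matrixP => i; rewrite !rowE h. Qed.

Lemma reflectionK {R : realFieldType} {n} (v : 'rV[R]_n) :
  v != 0 -> reflection v *m reflection v = 1%:M.
Proof.
rewrite -dotv_eq0 => v0; apply: eq_mulmx_row => x.
rewrite mulmxA mulmx1 !mulmx_reflection dotvBl dotvZl.
rewrite -addrA -opprD -scalerDl.
rewrite [X in X *: v](_ : _ = 0) ?scale0r ?subr0 //.
by field.
Qed.

Lemma reflection_swap {R : realFieldType} {n} (u w : 'rV[R]_n) :
  u != w -> dotv u u = dotv w w -> u *m reflection (u - w) = w.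
Proof.
rewrite -subr_eq0 -dotv_eq0 => uw e; rewrite mulmx_reflection.
rewrite (_ : _ * _ = 1); first by rewrite scale1r opprB addrC subrK.
have E : dotv (u - w) (u - w) = 2 * dotv u (u - w).
  by rewrite !dotvBl !dotvBr (dotvC w u) -e; ring.
rewrite E in uw *; field.
by apply: contraNneq uw => ->; rewrite mulr0.
Qed.

Lemma reflection_conj {R : realFieldType} {n} (v : 'rV[R]_n) (Q : 'M[R]_n) :
  Q *m Q^T = 1%:M -> reflection (v *m Q) = Q^T *m reflection v *m Q.
Proof.
move=> QQ; have QtQ := mulmx1C QQ.
rewrite /reflection mulmxBr mulmxBl mulmx1 QtQ dotv_mulmx -(mulmxA v) QQ mulmx1.
by rewrite trmx_mul -scalemxAr -scalemxAl !mulmxA.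
Qed.

Definition act4 {R : realType} (Q : 'M[R]_4) (x : R * R * R * R) : R * R * R * R :=
  uncoord4 (coord4 x *m Q).

Lemma coord4_act {R : realType} (Q : 'M[R]_4) x : coord4 (act4 Q x) = coord4 x *m Q.
Proof. exact: uncoord4K. Qed.

Lemma preserves_mulmx {R : realType} (Q Q' : 'M[R]_4) :
  preserves (leb4 R) (act4 Q) -> preserves (leb4 R) (act4 Q') ->
  preserves (leb4 R) (act4 (Q *m Q')).
Proof.
move=> h h'; rewrite (_ : act4 _ = act4 Q' \o act4 Q); first exact: preserves_comp.
by apply/funext => x /=; rewrite /act4 uncoord4K mulmxA.
Qed.

Lemma preserves_reflection {R : realType} (v : 'rV[R]_4) : v != 0 ->
  preserves (leb4 R) (act4 (reflection v)).
Proof.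
have main (w : 'rV[R]_4) : w 0 3%:R != 0 ->
    preserves (leb4 R) (act4 (reflection w)).
  move=> w3.
  have w0 : dotv w w != 0.
    by rewrite dotv_eq0; apply: contraNneq w3 => ->; rewrite mxE.
  pose k := 2 / dotv w w.
  have h := @preserves_reflection_last R (w 0 0) (w 0 1) (w 0 2%:R) (w 0 3%:R)
    (k * w 0 0) (k * w 0 1) (k * w 0 2%:R) (k * w 0 3%:R) w3.
  have E : k * w 0 0 * w 0 0 + k * w 0 1 * w 0 1 + k * w 0 2%:R * w 0 2%:R
      + k * w 0 3%:R * w 0 3%:R = 2.
    by rewrite -!mulrA -!mulrDr -(sum_I4 _ (fun j => w 0 j * w 0 j)) -dotvE mulVf ?mulr1.
  move: (h E); rewrite (_ : (fun x => _) = act4 (reflection w)) //.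
  apply/funext => x; rewrite /act4 mulmx_reflection -/k /uncoord4.
  rewrite !mxE (dotvE (coord4 x)) sum_I4 !mxE /=.
  by congr (_, _, _, _); ring.
move=> v0; have [v3|/main//] := eqVneq (v 0 3%:R) 0.
(* The case [main] covers [m], and the reflection in [m] sends [v] to a vector with last coordinate
   [- 2 * dotv v v / dotv m m], which [main] covers too. *)
pose m : 'rV[R]_4 := v + delta_mx 0 3%:R.
have m3 : m 0 3%:R != 0 by rewrite !mxE v3 add0r !eqxx oner_eq0.
have m0 : m != 0 by apply: contraNneq m3 => ->; rewrite mxE.
have mm : reflection m *m (reflection m)^T = 1%:M by rewrite reflection_tr reflectionK.
have E : reflection v =
    reflection m *m reflection (v *m reflection m) *m reflection m.
  rewrite (reflection_conj _ _ mm) reflection_tr !mulmxA reflectionK // mul1mx.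
  by rewrite -mulmxA reflectionK // mulmx1.
rewrite E; apply: preserves_mulmx; last exact: main.
apply: preserves_mulmx; first exact: main.
apply: main; rewrite mulmx_reflection !mxE v3 !eqxx !add0r mulr1 oppr_eq0.
have -> : dotv v m = dotv v v by rewrite dotvDr dotv_delta v3 addr0.
by rewrite !mulf_neq0 ?invr_eq0 ?dotv_eq0 // pnatr_eq0.
Qed.

(* Cartan-Dieudonne: reflections are used to fix the basis vectors one by one. *)
Lemma preserves_orthogonal {R : realType} (Q : 'M[R]_4) : Q *m Q^T = 1%:M ->
  preserves (leb4 R) (act4 Q).
Proof.
suff gen k : (k <= 4)%N -> forall Q' : 'M[R]_4, Q' *m Q'^T = 1%:M ->
    (forall i : 'I_4, (i < 4 - k)%N -> row i Q' = delta_mx 0 i) ->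
    preserves (leb4 R) (act4 Q').
  by move=> QQ; apply: (gen 4%N).
elim: k => [_ Q' _ h|k IH k4 Q' QQ h].
  have -> : Q' = 1%:M by apply/row_matrixP => i; rewrite row1 h // subn0.
  rewrite (_ : act4 _ = id); first by split.
  by apply/funext => x; rewrite /act4 mulmx1 coord4K.
have jlt : (4 - k.+1 < 4)%N by rewrite subSS ltnS leq_subr.
pose j := Ordinal jlt.
have jk (i : 'I_4) : (i < 4 - k)%N -> (i < 4 - k.+1)%N \/ i = j.
  rewrite -(subnSK k4) ltnS leq_eqVlt => /orP[/eqP ij|]; [right|by left].
  exact/val_inj.
have [rj|rj] := eqVneq (row j Q') (delta_mx 0 j).
  by apply: IH => //; [exact: ltnW|move=> i /jk[/h//|->]].
(* This reflection sends row [j] to the basis vector, both being unit vectors. It leaves the earlier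
   rows alone: they are basis vectors orthogonal to row [j] and to [delta_mx 0 j]. *)
pose v := row j Q' - delta_mx 0 j.
have v0 : v != 0 by rewrite subr_eq0.
have de i l : dotv (delta_mx 0 i) (delta_mx 0 l : 'rV[R]_4) = (i == l)%:R.
  by rewrite dotv_delta mxE eqxx eq_sym.
have vv : reflection v *m (reflection v)^T = 1%:M by rewrite reflection_tr reflectionK.
have -> : Q' = Q' *m reflection v *m reflection v.
  by rewrite -mulmxA reflectionK // mulmx1.
apply: preserves_mulmx; last exact: preserves_reflection.
apply: IH; first exact: ltnW.
  by rewrite trmx_mul mulmxA -(mulmxA Q') vv mulmx1.
move=> i /jk[il|->]; rewrite row_mul.
  have ij : i != j by apply: contraTneq il => ->; rewrite ltnn.
  rewrite mulmx_reflection (_ : dotv (row i Q') v = 0) ?mulr0 ?scale0r ?subr0 ?h //.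
  by rewrite /v dotvBr de -{1}(h i il) dotv_row QQ mxE (negbTE ij) subrr.
by apply: reflection_swap => //; rewrite dotv_row QQ mxE de.
Qed.

Local Notation R4 R := (measurableTypeR R * measurableTypeR R * measurableTypeR R
  * measurableTypeR R)%type.

(** * Measures of cones in the unit ball *)

Definition measurable4 {R : realType} (A : set 'rV[R]_4) : Prop :=
  measurable (coord4 @^-1` A : set (R4 R)).

Definition ae4 {R : realType} (P : 'rV[R]_4 -> Prop) : Prop :=
  {ae leb4 R, forall x, P (coord4 x)}.

Definition ball4 {R : realType} : set 'rV[R]_4 := [set v | dotv v v <= 1].

(** Intersecting with the ball turns a cone into the set used in the cone measure, and keeps the
    measure finite, so that [fine] loses nothing on measurable sets. *)
Definition ball_measure {R : realType} (A : set 'rV[R]_4) : R :=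
  fine (leb4 R (coord4 @^-1` (A `&` ball4))).

Lemma measurable_coord4 {R : realType} (i : 'I_4) :
  measurable_fun setT (fun x : R4 R => coord4 x 0 i).
Proof.
move: i; apply: forall_I4; under eq_fun do rewrite mxE /=.
- by do 2! apply: measurableT_comp => //.
- by do 2! apply: measurableT_comp => //.
- by apply: measurableT_comp.
- exact: measurable_snd.
Qed.

Lemma measurable_dotv {R : realType} (n : 'rV[R]_4) :
  measurable_fun setT (fun x : R4 R => dotv n (coord4 x)).
Proof.
under eq_fun do rewrite dotvE.
by apply: measurable_sum => i; apply: measurable_funM => //; exact: measurable_coord4.
Qed.

Lemma measurable_dotvv {R : realType} :
  measurable_fun setT (fun x : R4 R => dotv (coord4 x) (coord4 x)).
Proof.
under eq_fun do rewrite dotvE.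
by apply: measurable_sum => i; apply: measurable_funM => //; exact: measurable_coord4.
Qed.

Lemma measurable4_preimage {R : realType} (f : 'rV[R]_4 -> R) (I : interval R) :
  measurable_fun setT (f \o coord4) -> measurable4 (f @^-1` [set` I]).
Proof.
move=> mf; rewrite /measurable4 -[X in measurable X]setTI.
by apply: mf => //; exact: measurable_itv.
Qed.

Lemma measurable4_dotv_gt0 {R : realType} (n : 'rV[R]_4) : measurable4 [set v | 0 < dotv n v].
Proof.
rewrite (_ : [set v | _] = (dotv n) @^-1` [set` `]0, +oo[]); last first.
  by apply/seteqP; split => v /=; rewrite in_itv /= andbT.
by apply: measurable4_preimage; exact: measurable_dotv.
Qed.

Lemma measurable4_dotv_ge0 {R : realType} (n : 'rV[R]_4) : measurable4 [set v | 0 <= dotv n v].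
Proof.
rewrite (_ : [set v | _] = (dotv n) @^-1` [set` `[0, +oo[]); last first.
  by apply/seteqP; split => v /=; rewrite in_itv /= andbT.
by apply: measurable4_preimage; exact: measurable_dotv.
Qed.

Lemma measurable4_ball {R : realType} : measurable4 (@ball4 R).
Proof.
rewrite (_ : ball4 = (fun v => dotv v v) @^-1` [set` `]-oo, 1]]).
  by apply: measurable4_preimage; exact: measurable_dotvv.
by apply/seteqP; split => v /=; rewrite in_itv.
Qed.

Lemma measurable4I {R : realType} (A B : set 'rV[R]_4) :
  measurable4 A -> measurable4 B -> measurable4 (A `&` B).
Proof. by move=> mA mB; exact: measurableI. Qed.

Lemma measurable4C {R : realType} (A : set 'rV[R]_4) : measurable4 A -> measurable4 (~` A).
Proof. by move=> mA; exact: measurableC. Qed.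

Lemma measurable4T {R : realType} : measurable4 [set: 'rV[R]_4].
Proof. exact: measurableT. Qed.

Lemma leb4_box {R : realType} (r : R) : 0 < r ->
  leb4 R (`[- r, r] `*` `[- r, r] `*` `[- r, r] `*` `[- r, r])
    = ((2 * r) ^+ 4)%:E.
Proof.
move=> r0.
have h : @lebesgue_measure R `[- r, r]%classic = (2 * r)%:E.
  rewrite lebesgue_measure_itv /= lte_fin ifT; last lra.
  by rewrite -?EFinD; congr (_%:E); ring.
have mI : measurable (`[- r, r]%classic : set (measurableTypeR R)).
  exact: measurable_itv.
have m2 := measurableX mI mI.
have m3 := measurableX m2 mI.
have e2 : leb2 R (`[- r, r] `*` `[- r, r]) = ((2 * r) ^+ 2)%:E.
  apply: etrans (product_measure1E (@leb R) (@leb R) mI mI) _.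
  by rewrite [X in (X * _)%E]h [X in (_ * X)%E]h -EFinM.
have e3 : leb3 R (`[- r, r] `*` `[- r, r] `*` `[- r, r]) = ((2 * r) ^+ 3)%:E.
  apply: etrans (product_measure1E (leb2 R) (@leb R) m2 mI) _.
  by rewrite [X in (X * _)%E]e2 [X in (_ * X)%E]h -EFinM -exprSr.
apply: etrans (product_measure1E (leb3 R) (@leb R) m3 mI) _.
by rewrite [X in (X * _)%E]e3 [X in (_ * X)%E]h -EFinM -exprSr.
Qed.

Lemma ball4_coord {R : realType} (v : 'rV[R]_4) i : ball4 v -> -1 <= v 0 i <= 1.
Proof.
move=> bv; rewrite -ler_norml -(@ler_pXn2r _ 2) ?nnegrE // expr1n real_normK ?num_real //.
apply: le_trans bv; rewrite dotvE (bigD1 i) //= -expr2 lerDl.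
by apply: sumr_ge0 => j _; rewrite -expr2 sqr_ge0.
Qed.

Lemma ball4_fin {R : realType} : (leb4 R (coord4 @^-1` @ball4 R) < +oo)%E.
Proof.
apply: (@le_lt_trans _ _ ((2 * 1) ^+ 4)%:E); last exact: ltry.
rewrite -leb4_box //; apply: le_measure; rewrite ?inE.
- exact: measurable4_ball.
- by do 3! apply: measurableX => //; exact: measurable_itv.
move=> x /ball4_coord bx; rewrite /= !in_itv /=.
by have := (bx 0, bx 1, bx 2%:R, bx 3%:R); rewrite !mxE => -[[[]]].
Qed.

Lemma ball_measureT_gt0 {R : realType} : 0 < ball_measure [set: 'rV[R]_4].
Proof.
rewrite /ball_measure setTI fine_gt0 // ball4_fin andbT.
apply: (@lt_le_trans _ _ ((2 * (1 / 2 : R)) ^+ 4)%:E).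
  by rewrite lte_fin exprn_gt0 //; lra.
have h2 : 0 < 1 / 2 :> R by lra.
rewrite -leb4_box //; apply: le_measure; rewrite ?inE.
- by do 3! apply: measurableX => //; exact: measurable_itv.
- exact: measurable4_ball.
move=> [[[a b] c] d] /=; rewrite !in_itv /= => -[[[ha hb] hc] hd].
rewrite /ball4 /= dotvE sum_I4 !mxE /=.
have sq (x : R) : - (1 / 2) <= x <= 1 / 2 -> x * x <= 1 / 4.
  move=> /andP[x1 x2]; have : 0 <= (1 / 2 - x) * (x + 1 / 2) by apply: mulr_ge0; lra.
  by rewrite (_ : _ * _ = 1 / 4 - x * x) ?subr_ge0 //; field.
by move: (sq a ha) (sq b hb) (sq c hc) (sq d hd); lra.
Qed.

Lemma ball_measure_finE {R : realType} (A : set 'rV[R]_4) : measurable4 A ->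
  leb4 R (coord4 @^-1` (A `&` ball4)) = (ball_measure A)%:E.
Proof.
move=> mA; rewrite fineK // ge0_fin_numE //; apply: le_lt_trans ball4_fin.
apply: le_measure; rewrite ?inE.
- by apply: measurable4I => //; exact: measurable4_ball.
- exact: measurable4_ball.
by move=> x [].
Qed.

Lemma ball_measure_ge0 {R : realType} (A : set 'rV[R]_4) : 0 <= ball_measure A.
Proof. by rewrite fine_ge0. Qed.

(** The single source of the additivity relations below: a linear relation between indicators, valid
    almost everywhere, is integrated over the ball. *)
Lemma ball_measure_comb {R : realType} (s : seq (R * set 'rV[R]_4)) (k : R) :
  (forall p, List.In p s -> measurable4 p.2) ->
  ae4 (fun v => \sum_(p <- s) p.1 * \1_(p.2) v = k) ->
  \sum_(p <- s) p.1 * ball_measure p.2 = k * ball_measure setT.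
Proof.
move=> ms hs; set B := coord4 @^-1` @ball4 R.
have mB : measurable (B : set (R4 R)) by exact: measurable4_ball.
have int_ind (A : set 'rV[R]_4) c : measurable4 A ->
    (leb4 R).-integrable B (fun x : R4 R => (c * \1_A (coord4 x))%:E).
  move=> mA; under eq_fun do rewrite EFinM.
  apply: integrableZl => //; apply/integrableP; split.
    by apply/measurable_EFinP; exact: (@measurable_indic _ _ _ B (coord4 @^-1` A)).
  under eq_integral do rewrite gee0_abs ?lee_fin //.
  rewrite (integral_indic _ mB mA); apply: le_lt_trans ball4_fin.
  by apply: le_measure; rewrite ?inE //; apply: measurableI.
have int_indE (A : set 'rV[R]_4) c : measurable4 A ->
    (\int[leb4 R]_(x in B) (c * \1_A (coord4 x))%:E =
     (c * ball_measure A)%:E)%E.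
  move=> mA; have := int_ind A 1 mA.
  under eq_fun do rewrite mul1r; move=> iA.
  under eq_integral do rewrite EFinM.
  rewrite integralZl // EFinM; congr (_ * _)%E.
  by rewrite (integral_indic _ mB mA) -ball_measure_finE.
have sumE : forall t : seq (R * set 'rV[R]_4), (forall p, List.In p t -> measurable4 p.2) ->
    (leb4 R).-integrable B
      (fun x => (\sum_(p <- t) p.1 * \1_(p.2) (coord4 x))%:E) /\
    (\int[leb4 R]_(x in B)
      (\sum_(p <- t) p.1 * \1_(p.2) (coord4 x))%:E =
     (\sum_(p <- t) p.1 * ball_measure p.2)%:E)%E.
  elim=> [_|p t IH mt].
    under eq_fun do rewrite big_nil; rewrite big_nil.
    split; first exact: integrable0.
    by rewrite integral0.
  have [i1 e1] := IH (fun q qt => mt q (or_intror qt)).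
  have mp := mt p (or_introl erefl).
  have i2 := int_ind p.2 p.1 mp.
  have e2 := int_indE p.2 p.1 mp.
  under eq_fun do rewrite big_cons EFinD; rewrite big_cons EFinD -e1 -e2.
  split; first exact: integrableD.
  by rewrite integralD.
apply: EFin_inj; have [is1 <-] := sumE s ms.
rewrite -(int_indE setT k measurable4T).
apply: ae_eq_integral => //.
- by case/integrableP: is1.
- by case/integrableP: (int_ind setT k measurable4T).
move: hs; rewrite /ae4 /almost_everywhere; apply: negligibleS => x.
apply: contra_not => hx _; rewrite hx.
by rewrite indicE mem_set // mulr1.
Qed.

Lemma ae4W {R : realType} (P Q : 'rV[R]_4 -> Prop) :
  (forall v, P v -> Q v) -> ae4 P -> ae4 Q.
Proof.
move=> PQ; rewrite /ae4 /almost_everywhere; apply: negligibleS => x.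
by apply: contra_not; exact: PQ.
Qed.

Lemma ae4I {R : realType} (P Q : 'rV[R]_4 -> Prop) :
  ae4 P -> ae4 Q -> ae4 (fun v => P v /\ Q v).
Proof.
rewrite /ae4 /almost_everywhere => hP hQ.
apply: negligibleS (negligibleU hP hQ) => x /not_andP[nP|nQ]; [left|right] => //.
Qed.

(** The ball has positive measure, so a null set cannot be everything. This provides points in
    general position. *)
Lemma ae4_ex {R : realType} (P : 'rV[R]_4 -> Prop) : ae4 P -> exists v, P v.
Proof.
rewrite /ae4 /almost_everywhere => hP; apply: contrapT => nP.
have : (leb4 R).-negligible setT.
  by apply: negligibleS hP => x _ /= Px; apply: nP; exists (coord4 x).
move/(measure_negligible measurableT) => h0.
have := @ball_measureT_gt0 R; rewrite /ball_measure (_ : leb4 _ _ = 0%E) ?ltxx //.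
apply/eqP; rewrite eq_le measure_ge0 andbT -h0.
apply: le_measure; rewrite ?inE;
  [exact: measurable4I measurable4T measurable4_ball|exact: measurableT|by []].
Qed.

Lemma ae4_all {R : realType} {I : Type} (s : seq I) (P : I -> 'rV[R]_4 -> Prop) :
  (forall i, List.In i s -> ae4 (P i)) -> ae4 (fun v => forall i, List.In i s -> P i v).
Proof.
elim: s => [_|i s IH h].
  by apply: negligibleS (negligible_set0 _) => x; apply => j [].
have h1 := h i (or_introl erefl).
have h2 := IH (fun j js => h j (or_intror js)).
by apply: ae4W (ae4I _ _ h1 h2) => v [hi hs] j [<-//|/hs].
Qed.

Lemma ball_measure_orthogonal {R : realType} (Q : 'M[R]_4) (A : set 'rV[R]_4) :
  Q *m Q^T = 1%:M -> measurable4 A ->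
  ball_measure ((fun v => v *m Q) @^-1` A) = ball_measure A.
Proof.
move=> QQ mA; have [mQ pQ] := preserves_orthogonal Q QQ.
rewrite /ball_measure -[X in _ = fine X]pQ; last first.
  by apply: measurable4I => //; exact: measurable4_ball.
congr (fine (leb4 R _)); apply/seteqP; split => x /=;
by rewrite coord4_act /ball4 /= dotv_mulmx -mulmxA QQ mulmx1.
Qed.

(** A hyperplane is null: an orthogonal change of coordinates makes the last coordinate of its
    normal nonzero, and then every line parallel to the last axis meets it in one point. *)
Lemma ae4_dotv_neq0 {R : realType} (n : 'rV[R]_4) : n != 0 -> ae4 (fun v => dotv n v != 0).
Proof.
move=> n0.
have [Q [QQ nQ]] : exists Q : 'M[R]_4, Q *m Q^T = 1%:M /\ (n *m Q) 0 3%:R != 0.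
  have [n3|n3] := eqVneq (n 0 3%:R) 0; last first.
    by exists 1%:M; rewrite trmx1 !mulmx1.
  pose m : 'rV[R]_4 := n + delta_mx 0 3%:R.
  have m3 : m 0 3%:R != 0 by rewrite !mxE n3 add0r !eqxx oner_eq0.
  have m0 : m != 0 by apply: contraNneq m3 => ->; rewrite mxE.
  exists (reflection m); rewrite reflection_tr reflectionK //; split => //.
  rewrite mulmx_reflection !mxE n3 !eqxx !add0r mulr1 oppr_eq0.
  have -> : dotv n m = dotv n n by rewrite dotvDr dotv_delta n3 addr0.
  by rewrite !mulf_neq0 ?invr_eq0 ?dotv_eq0 // pnatr_eq0.
have [mQ pQ] := preserves_orthogonal Q^T (etrans (congr1 _ (trmxK Q)) (mulmx1C QQ)).
have mH (w : 'rV[R]_4) : measurable4 [set v | dotv w v = 0].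
  rewrite (_ : [set v | _] = [set v | 0 <= dotv w v] `&` ~` [set v | 0 < dotv w v]).
    by apply: measurable4I;
      [exact: measurable4_dotv_ge0|by apply: measurable4C; exact: measurable4_dotv_gt0].
  apply/seteqP; split => v /= => [->|[]]; first by rewrite lexx ltxx.
  by move=> h /negP; rewrite -leNgt => h'; apply/eqP; rewrite eq_le h h'.
rewrite /ae4 /almost_everywhere; exists (coord4 @^-1` [set v | dotv n v = 0]); split.
- exact: mH.
- rewrite -pQ; last exact: mH.
  rewrite [X in leb4 R X](_ : _ = coord4 @^-1` [set v | dotv (n *m Q) v = 0]); last first.
    have key x : dotv n (coord4 (act4 Q^T x)) = dotv (n *m Q) (coord4 x).
      by rewrite coord4_act dotvC dotv_mulmx trmxK dotvC.
    apply/seteqP; split => x h.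
      change (dotv (n *m Q) (coord4 x) = 0); rewrite -key; exact: h.
    change (dotv n (coord4 (act4 Q^T x)) = 0); rewrite key; exact: h.
  rewrite /leb4 /product_measure1; apply: integral0_eq => y _ /=.
  set w := n *m Q in nQ *; clearbody w.
  pose c := - (w 0 0 * y.1.1 + w 0 1 * y.1.2 + w 0 2%:R * y.2) / w 0 3%:R.
  rewrite (_ : xsection _ _ = [set c]) ?lebesgue_measure_set1 //.
  apply/seteqP; split => t; rewrite /xsection /= inE /= dotvE sum_I4 !mxE /= => h.
    by apply: (mulfI nQ); rewrite /c mulrCA divff // mulr1; lra.
  by rewrite h /c mulrCA divff // mulr1; ring.
- by move=> x /= /negP; rewrite negbK => /eqP.
Qed.

Lemma sum_nat_unique {R : pzSemiRingType} {I : finType} (Q : pred I) :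
  (forall i j, Q i -> Q j -> i = j) -> \sum_i (Q i)%:R = ([exists i, Q i])%:R :> R.
Proof.
move=> uQ; case: (pickP Q) => [i Qi|nQ]; last first.
  rewrite big1 => [|i _]; last by rewrite nQ.
  by rewrite (_ : [exists i, Q i] = false) //; apply/existsP => -[i]; rewrite nQ.
rewrite (_ : [exists i, Q i] = true); last by apply/existsP; exists i.
rewrite (bigD1 i) //= Qi big1 ?addr0 // => j ji.
by case: (boolP (Q j)) => // Qj; rewrite (uQ _ _ Qj Qi) eqxx in ji.
Qed.

(** * The five-term relation *)

(* The line [s |-> mu * t - s * mu] enters or leaves the open positive orthant
   through the [i]-th facet at the time [t i]; the left-hand side counts the
   passages at positive times, starting from the position at time [0], and the
   right-hand side is the position at time infinity. *)
Lemma orthant_passages {R : realFieldType} {I : finType} (mu t : I -> R) :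
  (forall i, mu i != 0) -> (forall i, t i != 0) -> injective t ->
  ([forall i, 0 < mu i * t i])%:R
    - \sum_i Num.sg (mu i)
        * ((0 < t i) && [forall j, (j != i) ==> (0 < mu j * (t j - t i))])%:R
  = ([forall i, mu i < 0])%:R :> R.
Proof.
move=> mu0 t0 tI.
pose E i := (0 < t i) && [forall j, (j != i) ==> (0 < mu j * (t j - t i))].
have EP i : reflect (0 < t i /\ forall j, j != i -> 0 < mu j * (t j - t i)) (E i).
  apply: (iffP andP) => -[ti h]; split => //; first move=> j ji.
    by move/forallP/(_ j)/implyP: h; apply.
  by apply/forallP => j; apply/implyP; exact: h.
have neg i : ~~ (0 < mu i) -> mu i < 0 by rewrite -leNgt lt_neqAle mu0.
have tneq i j : i != j -> t i != t j by apply: contra_neq; exact: tI.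
have Ep i j : 0 < mu j -> j != i -> E i -> t i < t j.
  by move=> pj ji /EP[_ /(_ j ji)]; rewrite pmulr_rgt0 // subr_gt0.
have En i j : ~~ (0 < mu j) -> j != i -> E i -> t j < t i.
  by move=> /neg nj ji /EP[_ /(_ j ji)]; rewrite nmulr_rgt0 // subr_lt0.
have Et i : E i -> 0 < t i by case/EP.
(* At time [s] the coordinates are [mu j * (t j - s)], so the line is in the orthant when [s]
   exceeds all [t j] with [mu j < 0] and is below all [t j] with [mu j > 0]. It therefore enters and
   leaves at most once: [X] says that it leaves at a positive time, [Y] that it enters at one. *)
pose X := [exists i, (0 < mu i) && E i].
pose Y := [exists i, ~~ (0 < mu i) && E i].
have -> : \sum_i Num.sg (mu i) * (E i)%:R = X%:R - Y%:R :> R.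
  rewrite /X -sum_nat_unique; last first.
    move=> i j /andP[pi Ei] /andP[pj Ej]; apply/eqP; apply: contraT => ij.
    have := Ep _ _ pi ij Ej; have := Ep j i.
    by rewrite eq_sym in ij; have := Ep _ _ pj ij Ei => h _ /(lt_trans h); rewrite ltxx.
  rewrite /Y -sum_nat_unique; last first.
    move=> i j /andP[pi Ei] /andP[pj Ej]; apply/eqP; apply: contraT => ij.
    have := En _ _ pi ij Ej.
    by rewrite eq_sym in ij; have := En _ _ pj ij Ei => h /(lt_trans h); rewrite ltxx.
  rewrite -sumrB; apply: eq_bigr => i _.
  have [pi|/neg ni] := boolP (0 < mu i); first by rewrite gtr0_sg // mul1r subr0.
  by rewrite ltr0_sg // mulN1r sub0r.
have XF i : 0 < mu i -> X -> t i < 0 -> False.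
  move=> pi /existsP[j /andP[pj Ej]] ti.
  have tj := Et _ Ej.
  have [e|/(Ep _ _ pi)/(_ Ej) h] := eqVneq i j; first by rewrite e in ti; lra.
  lra.
have Zp i : 0 < mu i -> [forall i, 0 < mu i * t i] -> 0 < t i.
  by move=> pi /forallP/(_ i); rewrite pmulr_rgt0.
have Zn i : ~~ (0 < mu i) -> [forall i, 0 < mu i * t i] -> t i < 0.
  by move=> /neg ni /forallP/(_ i); rewrite nmulr_rgt0.
have tlt i : 0 < t i \/ t i < 0 by have := t0 i; rewrite neq_lt => /orP[]; [right|left].
have [p pp|noP] := pickP (fun i => 0 < mu i); last first.
  have nn i : ~~ (0 < mu i) by rewrite noP.
  have -> : [forall i, mu i < 0] = true by apply/forallP => i; exact/neg.
  have -> : X = false by apply/existsP => -[i]; rewrite noP.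
  have [p _|noI] := pickP (fun _ : I => true); last first.
    have -> : [forall i, 0 < mu i * t i] = true by apply/forallP => i; have := noI i.
    have -> : Y = false by apply/existsP => -[i]; have := noI i.
    by rewrite !subr0.
  case: (@arg_maxP _ R I p predT t erefl) => a _ maxa.
  have [ta|ta] := tlt a.
    have -> : [forall i, 0 < mu i * t i] = false.
      by apply/negP => /(Zn _ (nn a)); lra.
    have -> : Y = true.
      apply/existsP; exists a; rewrite nn; apply/EP; split => // j ja.
      by rewrite nmulr_rgt0 ?neg // subr_lt0 lt_neqAle tneq //; exact: maxa.
    by rewrite !sub0r opprK.
  have -> : [forall i, 0 < mu i * t i] = true.
    by apply/forallP => i; rewrite nmulr_rgt0 ?neg //; exact: le_lt_trans (maxa i _) ta.
  have -> : Y = false; last by rewrite !subr0.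
  by apply/existsP => -[i /andP[_ /Et]]; have := maxa i erefl; rewrite /=; lra.
have -> : [forall i, mu i < 0] = false.
  by apply/negP => /forallP/(_ p) h; rewrite ltNge ltW in h.
(* [t b] is the only possible exit time, and [t a], chosen below among the negative [mu], the only
   possible entry time. What remains is the comparison of [t a], [t b] and [0]. *)
case: (@arg_minP _ R I p (fun i => 0 < mu i) t pp) => b pb minb {p pp}.
have [tb|tb] := tlt b; last first.
  have -> : X = false by apply/negbTE/negP => hX; exact: (XF b pb hX tb).
  have -> : [forall i, 0 < mu i * t i] = false by apply/negP => /(Zp _ pb); lra.
  have -> : Y = false; last by rewrite !subr0.
  apply/existsP => -[i /andP[ni Ei]]; have ti := Et _ Ei.
  have bi : b != i by apply: contraNneq ni => <-.
  by have := Ep _ _ pb bi Ei; lra.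
have [n nn|noN] := pickP (fun i => ~~ (0 < mu i)); last first.
  have allp i : 0 < mu i by apply/negPn; rewrite noN.
  have -> : Y = false by apply/existsP => -[i]; rewrite allp.
  have -> : [forall i, 0 < mu i * t i] = true.
    by apply/forallP => i; rewrite pmulr_rgt0 //; exact: lt_le_trans tb (minb i (allp i)).
  have -> : X = true; last by rewrite subr0 subrr.
  apply/existsP; exists b; rewrite pb; apply/EP; split => // j jb.
  rewrite pmulr_rgt0 // subr_gt0 lt_neqAle (minb j (allp j)) andbT.
  by apply: tneq; rewrite eq_sym.
case: (@arg_maxP _ R I n (fun i => ~~ (0 < mu i)) t nn) => a na maxa {n nn}.
have ab : a != b by apply: contraNneq na => ->.
have ba : b != a by rewrite eq_sym.
have := tneq _ _ ab; rewrite neq_lt => /orP[tab|tba]; last first.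
  have -> : X = false.
    apply/existsP => -[i /andP[pi Ei]].
    have ai : a != i by apply: contraNneq na => ->.
    have := En _ _ na ai Ei.
    by have [<-|bi] := eqVneq b i; [lra|have := Ep _ _ pb bi Ei; lra].
  have -> : Y = false.
    apply/existsP => -[i /andP[ni Ei]].
    have bi : b != i by apply: contraNneq ni => <-.
    have := Ep _ _ pb bi Ei.
    by have [<-|ai] := eqVneq a i; [lra|have := En _ _ na ai Ei; lra].
  have -> : [forall i, 0 < mu i * t i] = false; last by rewrite !subr0.
  by apply/negP => hZ; have := Zp _ pb hZ; have := Zn _ na hZ; lra.
have -> : X = true.
  apply/existsP; exists b; rewrite pb; apply/EP; split => // j jb.
  have [pj|nj] := boolP (0 < mu j).
    rewrite pmulr_rgt0 // subr_gt0 lt_neqAle (minb j pj) andbT.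
    by apply: tneq; rewrite eq_sym.
  by rewrite nmulr_rgt0 ?neg // subr_lt0; exact: le_lt_trans (maxa j nj) tab.
have [ta|ta] := tlt a.
  have -> : [forall i, 0 < mu i * t i] = false by apply/negP => /(Zn _ na); lra.
  have -> : Y = true; last by rewrite subrr subr0.
  apply/existsP; exists a; rewrite na; apply/EP; split => // j ja.
  have [pj|nj] := boolP (0 < mu j).
    by rewrite pmulr_rgt0 // subr_gt0; exact: lt_le_trans tab (minb j pj).
  by rewrite nmulr_rgt0 ?neg // subr_lt0 lt_neqAle tneq //=; exact: (maxa j nj).
have -> : Y = false.
  apply/existsP => -[i /andP[ni Ei]].
  by have := Et _ Ei; have := maxa i ni; rewrite /=; lra.
have -> : [forall i, 0 < mu i * t i] = true; last by rewrite subr0 subrr.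
apply/forallP => i; have [pi|ni] := boolP (0 < mu i).
  by rewrite pmulr_rgt0 //; exact: lt_le_trans tb (minb i pi).
by rewrite nmulr_rgt0 ?neg //; exact: le_lt_trans (maxa i ni) ta.
Qed.

(** The basis dual to the rows of [C]: [dotv (facet C i) v] is the coordinate of [v] along row [i],
    and [facet C i] is an inner normal to the face opposite to that row. *)
Definition facet {R : realType} (C : 'M[R]_4) (i : 'I_4) : 'rV[R]_4 :=
  (col i (invmx C))^T.

Lemma dotv_facet {R : realType} (C : 'M[R]_4) i v :
  dotv (facet C i) v = (v *m invmx C) 0 i.
Proof. by rewrite dotvE mxE; apply: eq_bigr => j _; rewrite !mxE mulrC. Qed.

Lemma facet_row {R : realType} (C : 'M[R]_4) i j : C \in unitmx ->
  dotv (facet C i) (row j C) = (j == i)%:R.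
Proof. by move=> uC; rewrite dotv_facet -row_mul mulmxV // row1 mxE eqxx eq_sym. Qed.

Lemma facet_neq0 {R : realType} (C : 'M[R]_4) i : C \in unitmx -> facet C i != 0.
Proof.
move=> uC; apply/negP => /eqP h; have := facet_row C i i uC.
by rewrite h eqxx dotvE big1 => [/eqP|j _]; rewrite ?mxE ?mul0r // eq_sym oner_eq0.
Qed.

Definition closed_cone {R : realType} (C : 'M[R]_4) : set 'rV[R]_4 :=
  [set v | forall i, 0 <= dotv (facet C i) v].

Definition open_cone {R : realType} (C : 'M[R]_4) : set 'rV[R]_4 :=
  [set v | forall i, 0 < dotv (facet C i) v].

Lemma measurable4_forall {R : realType} (A : 'I_4 -> set 'rV[R]_4) :
  (forall i, measurable4 (A i)) -> measurable4 [set v | forall i, A i v].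
Proof.
move=> h; rewrite (_ : [set v | _] = A 0 `&` (A 1 `&` (A 2%:R `&` A 3%:R))).
  by do !apply: measurable4I.
apply/seteqP; split => v; first by move=> Av; do !split; exact: Av.
by move=> [? [? [? ?]]]; exact: forall_I4.
Qed.

Lemma measurable4_closed_cone {R : realType} (C : 'M[R]_4) : measurable4 (closed_cone C).
Proof.
by apply: (@measurable4_forall _ (fun i => [set v | 0 <= dotv (facet C i) v])) => i;
  exact: measurable4_dotv_ge0.
Qed.

Lemma measurable4_open_cone {R : realType} (C : 'M[R]_4) : measurable4 (open_cone C).
Proof.
by apply: (@measurable4_forall _ (fun i => [set v | 0 < dotv (facet C i) v])) => i;
  exact: measurable4_dotv_gt0.
Qed.

Lemma ball_measure_ae {R : realType} (A B : set 'rV[R]_4) : measurable4 A -> measurable4 B ->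
  ae4 (fun v => A v <-> B v) -> ball_measure A = ball_measure B.
Proof.
move=> mA mB AB; apply/eqP; rewrite -subr_eq0; apply/eqP.
have := @ball_measure_comb R [:: (1, A); (-1, B)] 0.
rewrite !big_cons !big_nil /= mul0r !mul1r !mulN1r addr0; apply.
  by move=> p [<-//|[<-//|[]]].
apply: ae4W AB => v AB; rewrite !big_cons big_nil /= addr0 mul1r mulN1r.
by rewrite !indicE (_ : (v \in A) = (v \in B)) ?subrr //; apply/idP/idP;
  rewrite !inE => /AB.
Qed.

Lemma ae4_facets {R : realType} (C : 'M[R]_4) : C \in unitmx ->
  ae4 (fun v => forall i, dotv (facet C i) v != 0).
Proof.
move=> uC.
have h i : ae4 (fun v => dotv (facet C i) v != 0) by exact/ae4_dotv_neq0/facet_neq0.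
have := ae4I _ _ (h 0) (ae4I _ _ (h 1) (ae4I _ _ (h 2%:R) (h 3%:R))).
by apply: ae4W => v [? [? [? ?]]]; exact: forall_I4.
Qed.

Lemma ball_measure_open_cone {R : realType} (C : 'M[R]_4) : C \in unitmx ->
  ball_measure (closed_cone C) = ball_measure (open_cone C).
Proof.
move=> uC; apply: ball_measure_ae; [exact: measurable4_closed_cone|exact: measurable4_open_cone|].
apply: ae4W (ae4_facets C uC) => v v0; split=> h i; last exact: ltW.
by rewrite lt_neqAle eq_sym v0 h.
Qed.

Lemma ball_measureE {R : realType} (A : set 'rV[R]_4) :
  ball_measure A = fine (lebesgue_measure4 (coord4 @^-1` (A `&` ball4))).
Proof. by []. Qed.

Global Opaque ball_measure.

Lemma tetrahedron_oriented_volumeE {R : realType} (C : 'M[R]_4) : C \in unitmx ->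
  tetrahedron_oriented_volume C = Num.sg (\det C) * (4 * ball_measure (open_cone C)).
Proof.
move=> uC; rewrite /tetrahedron_oriented_volume /sphere3_volume; congr (_ * (_ * _)).
rewrite -(ball_measure_open_cone C uC) ball_measureE; congr (fine (lebesgue_measure4 _)).
have sE (v : 'rV[R]_4) : sphere3 v <-> dotv v v = 1.
  by rewrite /sphere3 /= dotvE; under eq_bigr do rewrite expr2.
apply/seteqP; split => x /=.
  move=> [r [a [/andP[r0 r1] [/sE sa [t [t0 ta]]] xa]]].
  rewrite -/(coord4 x) in xa; rewrite xa; split => [i|].
    rewrite dotvC dotvZl mulr_ge0 // dotvC dotv_facet ta mulmxK //; exact: t0.
  by rewrite /ball4 /= dotvZl dotvC dotvZl sa mulr1; exact: mulr_ile1.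
rewrite -/(coord4 x); move: (coord4 x) => v [cv bv].
have wit (w : 'rV[R]_4) : w != 0 -> closed_cone C w ->
    spherical_tetrahedron C ((Num.sqrt (dotv w w))^-1 *: w).
  move=> w0 cw; split.
    apply/sE; rewrite dotvZl dotvC dotvZl mulrA -expr2 exprVn sqr_sqrtr ?dotv_ge0 //.
    by rewrite mulVf // dotv_eq0.
  exists ((Num.sqrt (dotv w w))^-1 *: (w *m invmx C)); split => [i|].
    by rewrite mxE -dotv_facet mulr_ge0 ?invr_ge0 ?sqrtr_ge0.
  by rewrite -scalemxAl mulmxKV.
(* The origin has no direction; it is [0] times any point of the tetrahedron, here the normalized
   first vertex. *)
have [v0|v0] := eqVneq v 0.
  exists 0, ((Num.sqrt (dotv (row 0 C) (row 0 C)))^-1 *: row 0 C); split.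
  - by rewrite lexx ler01.
  - apply: wit => [|i]; last by rewrite facet_row // ler0n.
    apply/negP => /eqP h; have := facet_row C 0 0 uC.
    by rewrite h dotvC dotvE big1 => [/eqP|j _]; rewrite ?mxE ?mul0r // eqxx eq_sym oner_eq0.
  - by rewrite v0 scale0r.
exists (Num.sqrt (dotv v v)), ((Num.sqrt (dotv v v))^-1 *: v); split.
- by rewrite sqrtr_ge0 -sqrtr1 ler_wsqrtr.
- exact: wit.
- by rewrite scalerA mulfV ?scale1r // sqrtr_eq0 -ltNge lt_neqAle dotv_ge0 eq_sym dotv_eq0 v0.
Qed.

Definition replace_row {R : realType} (C : 'M[R]_4) (i : 'I_4) (w : 'rV[R]_4) : 'M[R]_4 :=
  \matrix_k (if k == i then w else row k C).

(** Cramer's rule: expansion along the replaced row meets the cofactors that make up column [i] of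
    the inverse. *)
Lemma det_replace_row {R : realType} (C : 'M[R]_4) i w : C \in unitmx ->
  \det (replace_row C i w) = dotv (facet C i) w * \det C.
Proof.
move=> uC; rewrite (expand_det_row _ i) dotv_facet.
rewrite /invmx uC -scalemxAr mxE mulrAC mulVf ?mul1r; last by rewrite -unitfE -unitmxE.
rewrite mxE; apply: eq_bigr => j _; rewrite !mxE eqxx; congr (_ * (_ * \det _)).
by apply/matrixP => a b; rewrite !mxE eq_sym (negbTE (neq_lift _ _)) !mxE.
Qed.

(** Solve the expansion of [w] for row [i] and substitute in that of [v]. In terms of the quotients
    [t j] of the coordinates of [v] and [w], the new coordinates are [t i] and [mu j * (t j - t i)],
    the quantities in [orthant_passages]. *)
Lemma facet_replace_row {R : realType} (C : 'M[R]_4) i w v : C \in unitmx ->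
  dotv (facet C i) w != 0 ->
  let t := dotv (facet C i) v / dotv (facet C i) w in
  forall j, dotv (facet (replace_row C i w) j) v =
    if j == i then t else dotv (facet C j) v - dotv (facet C j) w * t.
Proof.
move=> uC wi t j.
have uC' : replace_row C i w \in unitmx.
  by rewrite unitmxE unitfE det_replace_row // mulf_neq0 // -unitfE -unitmxE.
pose z : 'rV[R]_4 := \row_j (if j == i then t else
  dotv (facet C j) v - dotv (facet C j) w * t).
suff vz : v = z *m replace_row C i w.
  by rewrite {1}vz dotv_facet mulmxK // mxE.
have -> : z *m replace_row C i w = t *: w + (\row_j (if j == i then 0 else
    dotv (facet C j) v - dotv (facet C j) w * t)) *m C.
  rewrite !mulmx_sum_row (bigD1 i) //= [in RHS](bigD1 i) //= !mxE eqxx scale0r add0r.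
  rewrite rowK eqxx; congr (_ + _); apply: eq_bigr => k ki.
  by rewrite rowK !mxE (negbTE ki).
rewrite -[w in t *: w](mulmxKV uC) scalemxAl -mulmxDl.
rewrite -[LHS](mulmxKV uC); congr (_ *m C).
apply/rowP => k; rewrite [RHS]mxE [X in _ = X + _]mxE [X in _ = _ + X]mxE -!dotv_facet.
case: eqVneq => [->|_]; last by ring.
by rewrite addr0 /t divfK.
Qed.

(* The boundary of a 4-simplex with vertex [w] and opposite face [C] covers the
   sphere with a constant multiplicity. *)
Lemma oriented_volume_five_term {R : realType} (C : 'M[R]_4) (w : 'rV[R]_4) :
  C \in unitmx -> (forall i, dotv (facet C i) w != 0) ->
  tetrahedron_oriented_volume C
    - \sum_i tetrahedron_oriented_volume (replace_row C i w)
  = (Num.sg (\det C) * ([forall i, dotv (facet C i) w < 0])%:R)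
     * (4 * ball_measure [set: 'rV[R]_4]).
Proof.
move=> uC w0; set mu := fun i => dotv (facet C i) w.
have uC' i : replace_row C i w \in unitmx.
  by rewrite unitmxE unitfE det_replace_row // mulf_neq0 // -unitfE -unitmxE.
(* The passage times must be distinct. If times [i] and [j] coincide, [v] lies on the hyperplane
   whose normal is the difference of the facets divided by [mu i] and [mu j]; this normal is
   nonzero, as it takes the value [(mu i)^-1] on row [i]. *)
have aeI : ae4 (fun v => forall i j, i != j ->
    dotv (facet C i) v / mu i != dotv (facet C j) v / mu j).
  have hij i j : ae4 (fun v => i != j -> dotv (facet C i) v / mu i != dotv (facet C j) v / mu j).
    have [->|ij] := eqVneq i j; first exact: ae4W (ae4_facets C uC).
    have n0 : (mu i)^-1 *: facet C i - (mu j)^-1 *: facet C j != 0.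
      apply/negP => /eqP h; have := congr1 (dotv ^~ (row i C)) h.
      rewrite /= dotvBl !dotvZl !facet_row // eqxx (negbTE ij) mulr1 mulr0 subr0.
      rewrite dotvE big1 => [/eqP|k _]; last by rewrite mxE mul0r.
      by rewrite invr_eq0 (negbTE (w0 i)).
    apply: ae4W (ae4_dotv_neq0 _ n0) => v.
    by rewrite dotvBl !dotvZl subr_eq0 mulrC [X in _ != X]mulrC.
  pose s := [seq (i, j) | i <- enum 'I_4, j <- enum 'I_4].
  have /ae4W : ae4 (fun v => forall p, List.In p s -> p.1 != p.2 ->
      dotv (facet C p.1) v / mu p.1 != dotv (facet C p.2) v / mu p.2).
    by apply: ae4_all => p _; exact: hij.
  apply => v h i j; apply: (h (i, j)).
  have : (i, j) \in s by apply/allpairsP; exists (i, j); rewrite !mem_enum.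
  by elim: (s) => // a l IH; rewrite inE => /orP[/eqP ->|/IH]; [left|right].
have := @ball_measure_comb R ((1, open_cone C) ::
  [seq (- Num.sg (mu i), open_cone (replace_row C i w)) | i <- index_enum 'I_4])
  ([forall i, mu i < 0])%:R.
rewrite big_cons big_map /= mul1r => key.
have {}key : ball_measure (open_cone C)
    + \sum_i (- Num.sg (mu i) * ball_measure (open_cone (replace_row C i w)))
    = ([forall i, mu i < 0])%:R * ball_measure [set: 'rV[R]_4].
  apply: key.
    move=> p [<-|]; first exact: measurable4_open_cone.
    by elim: (index_enum _) => //= i l IH [<-|/IH//]; exact: measurable4_open_cone.
  apply: ae4W (ae4I _ _ (ae4_facets C uC) aeI) => v [v0 vI].
  (* In row coordinates the line of [orthant_passages] is [v - s w]. It passes facet [i] at a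
     positive time exactly when [v] is in the cone where [w] replaces row [i]. *)
  pose t i := dotv (facet C i) v / mu i.
  have tE i : mu i * t i = dotv (facet C i) v by rewrite /t mulrC divfK //; exact: w0.
  rewrite big_cons big_map /= mul1r -(orthant_passages mu t) //.
  - rewrite -sumrN; congr (_ + _).
      rewrite indicE; congr ((_ : bool)%:R); apply/idP/forallP => [|h].
        by rewrite inE => h i; rewrite tE; exact: h.
      by rewrite inE => i; have := h i; rewrite tE.
    apply: eq_bigr => i _; rewrite mulNr; congr (- (_ * _)).
    rewrite indicE; congr ((_ : bool)%:R).
    have E j : j != i -> dotv (facet (replace_row C i w) j) v = mu j * (t j - t i).
      by move=> ji; rewrite facet_replace_row // (negbTE ji) mulrBr tE.
    have Ei : dotv (facet (replace_row C i w) i) v = t i.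
      by rewrite facet_replace_row // eqxx.
    apply/idP/andP => [|[ti /forallP h]].
      rewrite inE => h; split; first by rewrite -Ei.
      by apply/forallP => j; apply/implyP => ji; rewrite -E.
    rewrite inE => j; have [->|ji] := eqVneq j i; first by rewrite Ei.
    by rewrite E //; move/implyP: (h j); apply.
  - by move=> i; rewrite mulf_neq0 ?invr_eq0 //; exact: w0.
  - by move=> i j tij; apply/eqP; apply: contraT => /vI; rewrite -/(t i) tij eqxx.
rewrite tetrahedron_oriented_volumeE //.
rewrite mulrACA -/mu [_ * (4 * _)]mulrCA -mulrA -key.
rewrite !mulrDr; congr (_ + _); first by ring.
rewrite -sumrN !mulr_sumr; apply: eq_bigr => i _.
rewrite tetrahedron_oriented_volumeE // det_replace_row // sgrM -/(mu i); ring.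
Qed.

(** * Antisymmetry and rotation invariance of tetrahedron volumes *)

Definition rows4 {R : realType} (a b c d : 'rV[R]_4) : 'M[R]_4 :=
  \matrix_(i < 4) [:: a; b; c; d]`_i.

Lemma rows4_inj_row {R : realType} (A B : 'M[R]_4) :
  row 0 A = row 0 B -> row 1 A = row 1 B -> row 2%:R A = row 2%:R B ->
  row 3%:R A = row 3%:R B -> A = B.
Proof. by move=> *; apply/row_matrixP; exact: forall_I4. Qed.

Lemma row_rows4 {R : realType} (a b c d : 'rV[R]_4) :
  (row 0 (rows4 a b c d) = a) * (row 1 (rows4 a b c d) = b) *
  (row 2%:R (rows4 a b c d) = c) * (row 3%:R (rows4 a b c d) = d).
Proof. by do !split; rewrite rowK. Qed.

Lemma row_row_perm {T : Type} {m n} (s : 'S_m) (A : 'M[T]_(m, n)) i :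
  row i (row_perm s A) = row (s i) A.
Proof. by apply/rowP => j; rewrite !mxE. Qed.

Lemma rows4_swap01 {R : realType} (a b c d : 'rV[R]_4) :
  rows4 b a c d = xrow 0 1 (rows4 a b c d).
Proof.
by apply: rows4_inj_row; rewrite row_rows4 /xrow row_row_perm permE /= row_rows4.
Qed.

Lemma rows4_swap12 {R : realType} (a b c d : 'rV[R]_4) :
  rows4 a c b d = xrow 1 2%:R (rows4 a b c d).
Proof.
by apply: rows4_inj_row; rewrite row_rows4 /xrow row_row_perm permE /= row_rows4.
Qed.

Lemma rows4_swap23 {R : realType} (a b c d : 'rV[R]_4) :
  rows4 a b d c = xrow 2%:R 3%:R (rows4 a b c d).
Proof.
by apply: rows4_inj_row; rewrite row_rows4 /xrow row_row_perm permE /= row_rows4.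
Qed.

Lemma rows4_mulmx {R : realType} (a b c d : 'rV[R]_4) (Q : 'M[R]_4) :
  rows4 a b c d *m Q = rows4 (a *m Q) (b *m Q) (c *m Q) (d *m Q).
Proof. by apply: rows4_inj_row; rewrite row_mul !row_rows4. Qed.

Lemma replace_rows4 {R : realType} (a b c d w : 'rV[R]_4) :
  (replace_row (rows4 a b c d) 0 w = rows4 w b c d) *
  (replace_row (rows4 a b c d) 1 w = rows4 a w c d) *
  (replace_row (rows4 a b c d) 2%:R w = rows4 a b w d) *
  (replace_row (rows4 a b c d) 3%:R w = rows4 a b c w).
Proof. by do !split; apply: rows4_inj_row; rewrite rowK /= !row_rows4. Qed.

Lemma det_xrow {R : comNzRingType} {n} (i j : 'I_n) (A : 'M[R]_n) :
  i != j -> \det (xrow i j A) = - \det A.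
Proof. by move=> ij; rewrite xrowE det_mulmx det_perm odd_tperm ij expr1 mulN1r. Qed.

Lemma spherical_tetrahedron_xrow {R : realType} i j (C : 'M[R]_4) :
  spherical_tetrahedron (xrow i j C) = spherical_tetrahedron C.
Proof.
have sub (D : 'M[R]_4) : spherical_tetrahedron (xrow i j D) `<=` spherical_tetrahedron D.
  move=> x [sx [t [t0 xE]]]; split; first by [].
  exists (t *m tperm_mx i j); rewrite xE xrowE mulmxA; split => // k.
  by rewrite -xcolE mxE.
apply/seteqP; split; first exact: sub.
have {1}-> : C = xrow i j (xrow i j C); last exact: sub.
by rewrite /xrow -row_permM tperm2 row_perm1.
Qed.

Lemma oriented_volume_xrow {R : realType} i j (C : 'M[R]_4) : i != j ->
  tetrahedron_oriented_volume (xrow i j C) = - tetrahedron_oriented_volume C.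
Proof.
move=> ij; rewrite /tetrahedron_oriented_volume spherical_tetrahedron_xrow.
by rewrite det_xrow // sgrN mulNr.
Qed.

Lemma oriented_volume_mulmx {R : realType} (C Q : 'M[R]_4) : rotation Q ->
  C \in unitmx ->
  tetrahedron_oriented_volume (C *m Q) = tetrahedron_oriented_volume C.
Proof.
move=> [QQ dQ] uC.
have uQ : Q \in unitmx by rewrite unitmxE dQ unitr1.
have uCQ : C *m Q \in unitmx by rewrite unitmx_mul uC.
have iCQ : invmx (C *m Q) = Q^T *m invmx C.
  by rewrite -[RHS](mulKmx uCQ) -(mulmxA C) (mulmxA Q) QQ mul1mx mulmxV // mulmx1.
rewrite (tetrahedron_oriented_volumeE _ uCQ) (tetrahedron_oriented_volumeE _ uC).
rewrite det_mulmx dQ mulr1; apply: (congr1 (fun x => _ * (4 * x))).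
rewrite -[RHS](ball_measure_orthogonal Q^T (open_cone C)); last 2 first.
- by rewrite trmxK (mulmx1C QQ).
- exact: measurable4_open_cone.
congr ball_measure; apply/seteqP; split => v h i; have := h i;
by rewrite !dotv_facet iCQ mulmxA.
Qed.

Definition tvol {R : realType} (a b c d : 'rV[R]_4) : R :=
  tetrahedron_oriented_volume (rows4 a b c d).

Lemma tvol_swap01 {R : realType} (a b c d : 'rV[R]_4) : tvol b a c d = - tvol a b c d.
Proof. by rewrite /tvol rows4_swap01 oriented_volume_xrow. Qed.

Lemma tvol_swap12 {R : realType} (a b c d : 'rV[R]_4) : tvol a c b d = - tvol a b c d.
Proof. by rewrite /tvol rows4_swap12 oriented_volume_xrow. Qed.

Lemma tvol_swap23 {R : realType} (a b c d : 'rV[R]_4) : tvol a b d c = - tvol a b c d.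
Proof. by rewrite /tvol rows4_swap23 oriented_volume_xrow. Qed.

Lemma tvolE {R : realType} (a b c d : 'rV[R]_4) :
  tvol a b c d = tetrahedron_oriented_volume (rows4 a b c d).
Proof. by []. Qed.

Global Opaque tvol.

(* Everything below uses only that this volume is positive and finite, not that it is
   [2 * pi ^+ 2]. *)
Definition sphere_total {R : realType} : R := 4 * ball_measure [set: 'rV[R]_4].

Definition full_turns {R : realType} : {pred R} := [pred x | x / sphere_total \is a Num.int].

Lemma full_turns_zmod_closed {R : realType} : zmod_closed (@full_turns R).
Proof.
split=> [|x y]; rewrite !inE ?mul0r ?rpred0 // => hx hy.
by rewrite mulrBl rpredB.
Qed.

HB.instance Definition _ (R : realType) :=
  GRing.isZmodClosed.Build R (@full_turns R) (@full_turns_zmod_closed R).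

Lemma sphere_total_neq0 {R : realType} : @sphere_total R != 0.
Proof. by rewrite mulf_neq0 ?lt0r_neq0 // ball_measureT_gt0. Qed.

Lemma tvol_five_term {R : realType} (a b c d w : 'rV[R]_4) :
  rows4 a b c d \in unitmx -> (forall i, dotv (facet (rows4 a b c d) i) w != 0) ->
  tvol a b c d - (tvol w b c d + tvol a w c d + tvol a b w d + tvol a b c w)
    \in @full_turns R.
Proof.
move=> uC w0; have := oriented_volume_five_term _ _ uC w0.
rewrite sum_I4 !replace_rows4 -/(tvol _ _ _ _) => ->.
rewrite inE -/sphere_total mulfK ?sphere_total_neq0 //.
by rewrite rpredM ?rpred_nat //; case: sgrP => _; rewrite ?rpredN ?rpred0 ?rpred1.
Qed.

(** * Oriented volume of an octahedron *)

Definition vertex {R : realType} (P : octahedron R) (i : 'I_3) (b : bool) : 'rV[R]_4 :=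
  row i (if b then P.2 else P.1).

(** The apex takes row [0], so the swap of the first two vertices of a face becomes a swap of rows
    [1] and [2]. *)
Lemma face_coneE {R : realType} (P : octahedron R) o (s : {ffun 'I_3 -> bool}) :
  let C := rows4 o (vertex P 0 (s 0)) (vertex P 1 (s 1)) (vertex P 2%:R (s 2%:R)) in
  face_cone P o s = if odd #|[set i | s i]%SET| then xrow 1 2%:R C else C.
Proof.
have E (F : 'M[R]_(3, 4)) : col_mx o F = rows4 o (row 0 F) (row 1 F) (row 2%:R F).
  apply: rows4_inj_row; rewrite row_rows4.
  - have -> : 0 = lshift 3 (0 : 'I_1) by apply/val_inj.
    exact: etrans (rowKu (0 : 'I_1) o F) (row_id _ o).
  - have -> : 1 = rshift 1 (0 : 'I_3) by apply/val_inj.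
    exact: (rowKd (0 : 'I_3) o F).
  - have -> : 2%:R = rshift 1 (1 : 'I_3) by apply/val_inj.
    exact: (rowKd (1 : 'I_3) o F).
  - have -> : 3%:R = rshift 1 (2%:R : 'I_3) by apply/val_inj.
    exact: (rowKd (2%:R : 'I_3) o F).
rewrite /face_cone /positive_face; case: ifP => _; rewrite E.
  by rewrite /xrow !row_row_perm !permE /= !rowK -/(xrow _ _ _) -rows4_swap12.
by rewrite !rowK.
Qed.

Lemma forall_I3 (P : 'I_3 -> Prop) : P 0 -> P 1 -> P 2%:R -> forall i, P i.
Proof.
move=> P0 P1 P2 [[|[|[|//]]] h].
- by rewrite (_ : Ordinal h = 0) //; exact/val_inj.
- by rewrite (_ : Ordinal h = 1) //; exact/val_inj.
- by rewrite (_ : Ordinal h = 2%:R) //; exact/val_inj.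
Qed.

Lemma sum_ffun_I3 (V : nmodType) (F : bool -> bool -> bool -> V) :
  \sum_(s : {ffun 'I_3 -> bool}) F (s 0) (s 1) (s 2%:R) =
  \sum_b0 \sum_b1 \sum_b2 F b0 b1 b2.
Proof.
pose g (p : bool * (bool * bool)) := [ffun i : 'I_3 => nth false [:: p.1; p.2.1; p.2.2] i].
rewrite (reindex g) /=; last first.
  exists (fun s => (s 0, (s 1, s 2%:R))) => [[b0 [b1 b2]] _|s _]; first by rewrite !ffunE.
  by apply/ffunP; apply: forall_I3; rewrite ffunE.
transitivity (\sum_(p : bool * (bool * bool)) F p.1 p.2.1 p.2.2).
  by apply: eq_bigr => p _; rewrite !ffunE.
rewrite -(pair_bigA _ (fun b0 p => F b0 p.1 p.2)) /=; apply: eq_bigr => b0 _.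
by rewrite -(pair_bigA _ (fun b1 b2 => F b0 b1 b2)).
Qed.

Lemma odd_card_I3 (s : {ffun 'I_3 -> bool}) :
  odd #|[set i | s i]%SET| = s 0 (+) s 1 (+) s 2%:R.
Proof.
have -> : #|[set i | s i]%SET| = (s 0%R + (s 1%R + (s (2%:R)%R + 0)))%N.
  rewrite cardsE -sum1_card big_mkcond /= !big_ord_recl big_ord0 /=.
  have -> : lift ord0 (lift ord0 ord0) = 2%:R :> 'I_3 by apply/val_inj.
  have -> : lift ord0 ord0 = 1 :> 'I_3 by apply/val_inj.
  by rewrite /in_mem /=; case: (s 0); case: (s 1); case: (s 2%:R).
by case: (s 0); case: (s 1); case: (s 2%:R).
Qed.

Definition fan {R : realType} (P : octahedron R) (o : 'rV[R]_4) : R :=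
  \sum_b0 \sum_b1 \sum_b2 (-1) ^+ (b0 (+) b1 (+) b2)
    * tvol o (vertex P 0 b0) (vertex P 1 b1) (vertex P 2%:R b2).

Lemma sum_face_cones {R : realType} (P : octahedron R) o :
  \sum_(s : {ffun 'I_3 -> bool}) tetrahedron_oriented_volume (face_cone P o s) = fan P o.
Proof.
rewrite /fan -(sum_ffun_I3 _ (fun b0 b1 b2 => (-1) ^+ (b0 (+) b1 (+) b2)
    * tvol o (vertex P 0 b0) (vertex P 1 b1) (vertex P 2%:R b2))).
apply: eq_bigr => s _; rewrite face_coneE odd_card_I3.
by case: (_ (+) _); rewrite ?expr0 ?mul1r // expr1 mulN1r oriented_volume_xrow.
Qed.

Lemma face_cone_unit {R : realType} (P : octahedron R) o s :
  (face_cone P o s \in unitmx) =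
  (rows4 o (vertex P 0 (s 0)) (vertex P 1 (s 1)) (vertex P 2%:R (s 2%:R)) \in unitmx).
Proof.
rewrite face_coneE; case: ifP => // _.
by rewrite !unitmxE det_xrow // unitrN.
Qed.

(** The five-term relation is applied to every face cone and [o']. A term where [o'] replaces a
    vertex of the face no longer involves that vertex, so it occurs in two adjacent faces with
    opposite signs and cancels. *)
Lemma fan_apex {R : realType} (P : octahedron R) (o o' : 'rV[R]_4) :
  (forall b0 b1 b2, let C := rows4 o (vertex P 0 b0) (vertex P 1 b1) (vertex P 2%:R b2) in
    C \in unitmx /\ forall i, dotv (facet C i) o' != 0) ->
  fan P o - fan P o' \in @full_turns R.
Proof.
move=> h; pose V b0 b1 b2 x y := let u := vertex P 0 b0 in let v := vertex P 1 b1 in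
  let w := vertex P 2%:R b2 in
  tvol x u v w - (tvol y u v w + tvol x y v w + tvol x u y w + tvol x u v y).
suff -> : fan P o - fan P o' = \sum_b0 \sum_b1 \sum_b2
    (-1) ^+ (b0 (+) b1 (+) b2) * V b0 b1 b2 o o'.
  apply: rpred_sum => b0 _; apply: rpred_sum => b1 _; apply: rpred_sum => b2 _.
  by rewrite rpredMsign; apply: tvol_five_term; have [] := h b0 b1 b2.
rewrite /fan /V; move: (@tvol R) (vertex P) => T U.
by rewrite !big_bool /= expr0 expr1; ring.
Qed.

(** The five-term relation for [[a b u v]] and [o]: replacing [a] or [b] by [o] gives face cones up
    to a permutation, while the terms where [o] replaces [u] or [v] cancel in the alternating
    sum. *)
Lemma fan_axis {R : realType} (P : octahedron R) (o : 'rV[R]_4) :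
  (forall b0 b1, let C := rows4 (vertex P 2%:R false) (vertex P 2%:R true)
      (vertex P 0 b0) (vertex P 1 b1) in
    C \in unitmx /\ forall i, dotv (facet C i) o != 0) ->
  fan P o + \sum_b0 \sum_b1 (-1) ^+ (b0 (+) b1)
      * tvol (vertex P 2%:R false) (vertex P 2%:R true) (vertex P 0 b0) (vertex P 1 b1)
    \in @full_turns R.
Proof.
move=> h; set a := vertex P 2%:R false in h *; set b := vertex P 2%:R true in h *.
pose V b0 b1 := let u := vertex P 0 b0 in let v := vertex P 1 b1 in
  tvol a b u v - (tvol o b u v + tvol a o u v + tvol a b o v + tvol a b u o).
suff -> : fan P o + \sum_b0 \sum_b1 (-1) ^+ (b0 (+) b1)
      * tvol a b (vertex P 0 b0) (vertex P 1 b1) =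
    \sum_b0 \sum_b1 (-1) ^+ (b0 (+) b1) * V b0 b1.
  apply: rpred_sum => b0 _; apply: rpred_sum => b1 _.
  by rewrite rpredMsign; apply: tvol_five_term; have [] := h b0 b1.
have e u v : tvol o b u v = tvol o u v b by rewrite tvol_swap12 tvol_swap23 opprK.
have e' u v : tvol a o u v = - tvol o u v a.
  by rewrite tvol_swap01 tvol_swap12 tvol_swap23 opprK.
rewrite /fan /V; under [in RHS]eq_bigr do under eq_bigr do rewrite e e'.
rewrite /a /b; move: (@tvol R) (vertex P) => T U.
by rewrite !big_bool /= expr0 expr1; ring.
Qed.

Lemma unitmx_swap01 {R : realType} (a b c d : 'rV[R]_4) :
  (rows4 b a c d \in unitmx) = (rows4 a b c d \in unitmx).
Proof. by rewrite rows4_swap01 !unitmxE det_xrow // unitrN. Qed.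

Lemma unitmx_swap12 {R : realType} (a b c d : 'rV[R]_4) :
  (rows4 a c b d \in unitmx) = (rows4 a b c d \in unitmx).
Proof. by rewrite rows4_swap12 !unitmxE det_xrow // unitrN. Qed.

Lemma unitmx_swap23 {R : realType} (a b c d : 'rV[R]_4) :
  (rows4 a b d c \in unitmx) = (rows4 a b c d \in unitmx).
Proof. by rewrite rows4_swap23 !unitmxE det_xrow // unitrN. Qed.

Lemma replace_row_unit {R : realType} (C : 'M[R]_4) i w : C \in unitmx ->
  (replace_row C i w \in unitmx) = (dotv (facet C i) w != 0).
Proof.
move=> uC; rewrite unitmxE unitfE det_replace_row // mulf_eq0 negb_or.
by rewrite -(unitfE (\det C)) -unitmxE uC andbT.
Qed.

Section axis.
Context {R : realType} (P : octahedron R).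
Let axis b0 b1 := rows4 (vertex P 2%:R false) (vertex P 2%:R true)
      (vertex P 0 b0) (vertex P 1 b1).
Hypothesis uaxis : forall b0 b1, axis b0 b1 \in unitmx.

Lemma ae4_axis : ae4 (fun v => forall b0 b1 i, dotv (facet (axis b0 b1) i) v != 0).
Proof.
have h b0 b1 := ae4_facets _ (uaxis b0 b1).
have := ae4I _ _ (ae4I _ _ (h true true) (h true false))
                 (ae4I _ _ (h false true) (h false false)).
by apply: ae4W => v [[? ?] [? ?]] [] [].
Qed.

(** Coordinates [0] and [1] of [v] belong to the ends of the diagonal; putting [v] in place of one
    end leaves a face that contains the other. *)
Lemma axis_faces_unit (v : 'rV[R]_4) :
  (forall b0 b1 i, dotv (facet (axis b0 b1) i) v != 0) ->
  forall b0 b1 b2, rows4 v (vertex P 0 b0) (vertex P 1 b1) (vertex P 2%:R b2) \in unitmx.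
Proof.
move=> h b0 b1 b2; rewrite unitmx_swap23 unitmx_swap12.
have h0 := h b0 b1 0; have h1 := h b0 b1 1.
rewrite -replace_row_unit // replace_rows4 in h0.
rewrite -replace_row_unit // replace_rows4 in h1.
by case: b2; [exact: h0|rewrite unitmx_swap01].
Qed.

(** Without it, [get] in the definition of the volume could return a default value instead of an
    admissible apex. *)
Lemma admissible_apex_nonempty : admissible_apex P !=set0.
Proof.
have [v hv] := ae4_ex _ ae4_axis.
have v0 : v != 0.
  apply: contraTneq (hv true true 0) => ->.
  by rewrite dotvE big1 ?eqxx // => j _; rewrite [X in _ * X]mxE mulr0.
have k0 : Num.sqrt (dotv v v) != 0.
  by rewrite sqrtr_eq0 -ltNge lt_neqAle dotv_ge0 eq_sym dotv_eq0 v0.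
exists ((Num.sqrt (dotv v v))^-1 *: v); split.
  rewrite /sphere3 /=; under eq_bigr do rewrite expr2.
  rewrite -dotvE dotvZl dotvC dotvZl mulrA -expr2 exprVn sqr_sqrtr ?dotv_ge0 //.
  by rewrite mulVf // dotv_eq0.
move=> s; rewrite face_cone_unit; apply: axis_faces_unit => b0 b1 i.
by rewrite dotvC dotvZl dotvC mulf_neq0 ?invr_eq0.
Qed.

Lemma octahedron_fan_axis (o : 'rV[R]_4) : admissible_apex P o ->
  fan P o + \sum_b0 \sum_b1 (-1) ^+ (b0 (+) b1)
      * tvol (vertex P 2%:R false) (vertex P 2%:R true) (vertex P 0 b0) (vertex P 1 b1)
    \in @full_turns R.
Proof.
move=> [_ ho].
have uo b0 b1 b2 : rows4 o (vertex P 0 b0) (vertex P 1 b1) (vertex P 2%:R b2) \in unitmx.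
  have := ho [ffun i : 'I_3 => nth false [:: b0; b1; b2] i].
  by rewrite face_cone_unit !ffunE.
(* An admissible [o] may still lie in the hyperplane of a face of a diagonal tetrahedron, where
   [fan_axis] does not apply. A generic apex [w] is interposed: [fan_apex] leads from [o] to [w],
   then [fan_axis] applies to [w]. *)
have h b0 b1 := ae4I _ _ (ae4_facets _ (uo b0 b1 true)) (ae4_facets _ (uo b0 b1 false)).
have [w [h1 [[h2 h3] [h4 h5]]]] := ae4_ex _ (ae4I _ _ ae4_axis (ae4I _ _
  (ae4I _ _ (h true true) (h true false)) (ae4I _ _ (h false true) (h false false)))).
rewrite -(subrK (fan P w) (fan P o)) -addrA; apply: rpredD.
  apply: fan_apex => b0 b1 b2; split; first exact: uo.
  by case: b0; case: b1; case: b2; [case: h2|case: h2|case: h3|case: h3|case: h4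
    |case: h4|case: h5|case: h5].
by apply: fan_axis => b0 b1; split; [exact: uaxis|exact: h1].
Qed.

End axis.

(** * Wedges and Girard's formula *)

Lemma ball_measure_split {R : realType} (A B : set 'rV[R]_4) : measurable4 A -> measurable4 B ->
  ball_measure A = ball_measure (A `&` B) + ball_measure (A `&` ~` B).
Proof.
move=> mA mB.
have := @ball_measure_comb R [:: (1, A); (-1, A `&` B); (-1, A `&` ~` B)] 0.
rewrite !big_cons big_nil /= mul0r mul1r !mulN1r addr0 => h.
apply/eqP; rewrite -subr_eq0 opprD; apply/eqP; apply: h.
  move=> p [<-|[<-|[<-|[]]]] //; apply: measurable4I => //; exact: measurable4C.
apply: (@ae4W _ (fun _ => True)); last first.
  by rewrite /ae4 /almost_everywhere; apply: negligibleS (negligible_set0 _) => x; apply.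
move=> v _; rewrite !big_cons big_nil /= !indicE !in_setI in_setC.
by case: (v \in A); case: (v \in B) => /=; ring.
Qed.

Lemma ball_measure_reflection {R : realType} (u : 'rV[R]_4) (A : set 'rV[R]_4) :
  u != 0 -> measurable4 A ->
  ball_measure ((fun v => v *m reflection u) @^-1` A) = ball_measure A.
Proof.
by move=> u0; apply: ball_measure_orthogonal; rewrite reflection_tr reflectionK.
Qed.

Lemma ae4_not_gt0 {R : realType} (n : 'rV[R]_4) : n != 0 ->
  ae4 (fun v => ~ 0 < dotv n v <-> 0 < dotv (- n) v).
Proof.
move=> n0; apply: ae4W (ae4_dotv_neq0 n n0) => v nv.
rewrite -scaleN1r dotvZl mulN1r oppr_gt0; split=> [/negP|h]; last by lra.
by rewrite -leNgt le_eqVlt (negbTE nv).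
Qed.

Lemma ball_measure_half {R : realType} (n : 'rV[R]_4) : n != 0 ->
  ball_measure [set v | 0 < dotv n v] = ball_measure [set: 'rV[R]_4] / 2.
Proof.
move=> n0; have mH := measurable4_dotv_gt0.
have := ball_measure_split [set: 'rV[R]_4] [set v | 0 < dotv n v] measurable4T (mH _ n).
rewrite !setTI (ball_measure_ae (~` _) [set v | 0 < dotv (- n) v]); last 3 first.
- by apply: measurable4C; exact: mH.
- exact: mH.
- exact: ae4_not_gt0.
rewrite -(ball_measure_reflection n [set v | 0 < dotv (- n) v]) //.
rewrite (_ : _ @^-1` _ = [set v | 0 < dotv n v]) => [->|]; first by field.
have key v : dotv (- n) (v *m reflection n) = dotv n v.
  rewrite dotvC dotv_mulmx reflection_tr mulmx_reflection -scaleN1r dotvZl.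
  rewrite mulrCA divfK ?dotv_eq0 // -scalerBl dotvZr dotvC; ring.
by apply/seteqP; split => v /=; rewrite key.
Qed.

(* If [g] is additive and vanishes at [p], then so do all multiples of each value
   of [g] modulo [p]; being bounded, they vanish. *)
Lemma bounded_additive_linear {R : realType} (w : R -> R) (p K : R) : 0 < p ->
  (forall a b, 0 <= a -> 0 <= b -> a + b < 2 * p -> w (a + b) = w a + w b) ->
  (forall a, 0 <= a < 2 * p -> `|w a| <= K) ->
  forall x, 0 <= x < 2 * p -> w x = w p * x / p.
Proof.
move=> p0 w_add w_bound.
pose c := w p / p; pose g x := w x - c * x.
have g_add a b : 0 <= a -> 0 <= b -> a + b < 2 * p -> g (a + b) = g a + g b.
  by move=> a0 b0 ab; rewrite /g w_add //; ring.
have g_p : g p = 0 by rewrite /g /c divfK ?gt_eqF // subrr.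
pose B := K + `|c| * (2 * p).
have g_bound a : 0 <= a < 2 * p -> `|g a| <= B.
  move=> /andP[a0 ap]; apply: le_trans (ler_normB _ _) _; apply: lerD.
    by apply: w_bound; rewrite a0.
  by rewrite normrM (ger0_norm a0) ler_wpM2l // ltW.
have g0 a : 0 <= a < p -> g a = 0.
  move=> /andP[a0 ah].
  have hn n : exists2 r, 0 <= r < p & g r = n%:R * g a.
    elim: n => [|n [r /andP[r0 rh] gr]].
      exists 0; first by rewrite lexx p0.
      rewrite mul0r; have := g_add 0 0 (lexx _) (lexx _).
      have p20 : 0 < 2 * p by lra.
      by rewrite addr0 => /(_ p20); lra.
    have ra : r + a < 2 * p by lra.
    have [h|h] := ltP (r + a) p.
      by exists (r + a); [rewrite h addr_ge0|rewrite g_add // gr -natr1; ring].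
    exists (r + a - p); first by apply/andP; split; lra.
    have := g_add (r + a - p) p; rewrite subrK g_add // g_p gr -natr1.
    by move=> h'; rewrite -[LHS]addr0 -h' //; [ring| |]; lra.
  apply/eqP; rewrite -normr_eq0; apply/eqP/le_anti; rewrite normr_ge0 andbT.
  rewrite leNgt; apply/negP => gp.
  have [r /andP[r0 rh] gr] := hn (Num.bound (B / `|g a|)).
  have gB : `|g r| <= B by apply: g_bound; apply/andP; split; lra.
  have B0 : 0 <= B := le_trans (normr_ge0 _) gB.
  move: gB; rewrite gr normrM normr_nat -ler_pdivlMr // leNgt.
  by rewrite archi_boundP // divr_ge0.
move=> x /andP[x0 xp].
suff : g x = 0 by rewrite /g /c => /subr0_eq ->; field; rewrite gt_eqF.
have [h|h] := ltP x p; first by rewrite g0 // x0.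
have -> : x = (x - p) + p by rewrite subrK.
by rewrite g_add ?g_p ?g0 ?addr0 // ?subrK //; try (apply/andP; split); lra.
Qed.

Section wedge.
Context {R : realType} (f1 f2 : 'rV[R]_4).
Hypotheses (f11 : dotv f1 f1 = 1) (f22 : dotv f2 f2 = 1) (f12 : dotv f1 f2 = 0).
Let M : R := ball_measure [set: 'rV[R]_4].

Let dir (x : R) : 'rV[R]_4 := cos x *: f1 + sin x *: f2.

Let dotv_dir x y : dotv (dir x) (dir y) = cos (x - y).
Proof.
rewrite /dir !dotvDl !dotvDr !dotvZl !dotvZr f11 f22 f12 (dotvC f2) f12 cosB; ring.
Qed.

Let dir_reflection x g : dir x *m reflection (dir g) = - dir (2 * g - x).
Proof.
rewrite mulmx_reflection !dotv_dir subrr cos0 divr1.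
rewrite (_ : 2 * g - x = g - (x - g)); last by ring.
rewrite /dir (cosB g) (sinB g).
have -> : cos x = cos (x - g) * cos g - sin (x - g) * sin g by rewrite -cosD subrK.
have -> : sin x = sin (x - g) * cos g + cos (x - g) * sin g by rewrite -sinD subrK.
by apply/rowP => j; rewrite !mxE; ring.
Qed.

(** Reflections whose normals differ by the angle [a / 2] compose to the rotation by [a]. *)
Let rot a := reflection (dir 0) *m reflection (dir (a / 2)).

Let dir_rot x a : dir x *m rot a = dir (x + a).
Proof.
rewrite /rot mulmxA dir_reflection mulNmx dir_reflection opprK.
by congr dir; field.
Qed.

Let rot_orthogonal a : rot a *m (rot a)^T = 1%:M.
Proof.
have d0 x : dir x != 0 by rewrite -dotv_eq0 dotv_dir subrr cos0 oner_eq0.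
rewrite /rot trmx_mul !reflection_tr -mulmxA (mulmxA (reflection (dir (a / 2)))).
by rewrite reflectionK // mul1mx reflectionK.
Qed.

(** The lune lost by a half-space when its normal turns from [dir x] to [dir y]. With a complement
    instead of an opposite open half-space, consecutive lunes fit together exactly. *)
Let slice x y : set 'rV[R]_4 :=
  [set v | 0 < dotv (dir x) v] `&` ~` [set v | 0 < dotv (dir y) v].

Let msb_slice x y : measurable4 (slice x y).
Proof.
by apply: measurable4I; [|apply: measurable4C]; exact: measurable4_dotv_gt0.
Qed.

Let w x := ball_measure (slice 0 x).

Let slice_shift x y : ball_measure (slice x (x + y)) = w y.
Proof.
rewrite /w -(ball_measure_orthogonal (rot x)^T (slice 0 y)); last 2 first.
- by rewrite trmxK (mulmx1C (rot_orthogonal x)).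
- exact: msb_slice.
congr ball_measure.
have e z v : dotv (dir (x + z)) v = dotv (dir z) (v *m (rot x)^T).
  by rewrite -dotv_mulmx dir_rot addrC.
by apply/seteqP; split => v; rewrite /slice /= !e -[in dir x](addr0 x) e.
Qed.

Let w_add_pos a b : 0 < a -> 0 <= b -> a + b < pi -> w (a + b) = w a + w b.
Proof.
move=> a0 b0 abpi; have ab0 : 0 < a + b by rewrite ltr_wpDr.
have sab : 0 < sin (a + b) by rewrite sin_gt0_pi // ab0.
have sa : 0 < sin a by apply: sin_gt0_pi; lra.
have sb : 0 <= sin b by apply: sin_ge0_pi; lra.
(* [dir a] is a nonnegative combination of [dir 0] and [dir (a + b)], so its hyperplane cuts the
   lune from [0] to [a + b] into the two expected lunes. The bound [a + b < pi] keeps [sin (a + b)]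
   positive. *)
have E v : sin (a + b) * dotv (dir a) v =
    sin b * dotv (dir 0) v + sin a * dotv (dir (a + b)) v.
  rewrite -!dotvZl -dotvDl; congr dotv; apply/rowP => j.
  rewrite /dir !mxE cos0 sin0 cosD sinD.
  have := cos2Dsin2 a; have := cos2Dsin2 b; move: (cos a) (cos b) (sin a) (sin b).
  move=> ca cb s1 s2 h2 h1.
  have -> : s2 * (1 * f1 0 j + 0 * f2 0 j) = s2 * (ca ^+ 2 + s1 ^+ 2) * f1 0 j.
    by rewrite h1; ring.
  by ring.
rewrite [RHS]addrC {1}/w (ball_measure_split _ [set v | 0 < dotv (dir a) v]); last 2 first.
- exact: msb_slice.
- exact: measurable4_dotv_gt0.
apply: (f_equal2 (fun x y => x + y)); last first.
  congr ball_measure; apply/seteqP; split => v; rewrite /slice /=; have := E v;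
  move: (dotv (dir 0) v) (dotv (dir a) v) (dotv (dir (a + b)) v) => x y z e.
    by move=> [[]].
  move=> [x0 /negP]; rewrite -leNgt => y0.
  split; [split => // z0|by apply/negP; rewrite -leNgt].
  have y1 : 0 <= - y by rewrite oppr_ge0.
  have := mulr_gt0 sa z0; have := mulr_ge0 sb (ltW x0).
  by have := mulr_ge0 (ltW sab) y1; lra.
apply: etrans _ (slice_shift a b).
congr ball_measure; apply/seteqP; split => v; rewrite /slice /=; have := E v;
move: (dotv (dir 0) v) (dotv (dir a) v) (dotv (dir (a + b)) v) => x y z e.
  by move=> [[]].
move=> [y0 /negP]; rewrite -leNgt => z0.
split => //; split; last by apply/negP; rewrite -leNgt.
rewrite ltNge; apply/negP => x0.
have x1 : 0 <= - x by rewrite oppr_ge0.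
have z1 : 0 <= - z by rewrite oppr_ge0.
have := mulr_gt0 sab y0; have := mulr_ge0 sb x1.
by have := mulr_ge0 (ltW sa) z1; lra.
Qed.
Let w_add a b : 0 <= a -> 0 <= b -> a + b < pi -> w (a + b) = w a + w b.
Proof.
have w0 : w 0 = 0.
  rewrite /w /slice setICr.
  have := ball_measure_split [set: 'rV[R]_4] [set: 'rV[R]_4] measurable4T measurable4T.
  by rewrite !setTI setCT -[X in X = _]addr0 => /addrI <-.
rewrite le_eqVlt => /predU1P[<- _ _|]; first by rewrite w0 !add0r.
exact: w_add_pos.
Qed.

Let f_neq0 (f : 'rV[R]_4) : dotv f f = 1 -> f != 0.
Proof. by rewrite -dotv_eq0 => ->; exact: oner_neq0. Qed.

(** The reflection in [f2] preserves the half-space of [f1] and exchanges the sides of [f2], so this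
    lune is half of a half-space. This value fixes the slope of [w]. *)
Let w_pihalf : w (pi / 2) = M / 4.
Proof.
have d0 : dir 0 = f1 by rewrite /dir cos0 sin0 scale1r scale0r addr0.
have d1 : dir (pi / 2) = f2 by rewrite /dir cos_pihalf sin_pihalf scale1r scale0r add0r.
have mH := @measurable4_dotv_gt0 R.
have := ball_measure_split [set v | 0 < dotv f1 v] [set v | 0 < dotv f2 v] (mH _) (mH _).
rewrite ball_measure_half ?f_neq0 // -/M /w /slice d0 d1.
have k1 v : dotv f1 (v *m reflection f2) = dotv f1 v.
  rewrite dotvC dotv_mulmx reflection_tr mulmx_reflection f12 mulr0 scale0r subr0.
  exact: dotvC.
have k2 v : dotv (- f2) (v *m reflection f2) = dotv f2 v.
  rewrite dotvC dotv_mulmx reflection_tr mulmx_reflection -scaleN1r dotvZl f22.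
  by rewrite divr1 -scalerBl dotvZr dotvC; ring.
have f20 := f_neq0 _ f22.
have mI (n n' : 'rV[R]_4) : measurable4 ([set v | 0 < dotv n v] `&` [set v | 0 < dotv n' v]).
  by apply: measurable4I; exact: mH.
have E : ball_measure ([set v | 0 < dotv f1 v] `&` [set v | 0 < dotv f2 v]) =
   ball_measure ([set v | 0 < dotv f1 v] `&` ~` [set v | 0 < dotv f2 v]).
  have h1 := ball_measure_reflection f2 _ f20 (mI f1 (- f2)).
  have h2 : ball_measure ([set v | 0 < dotv f1 v] `&` [set v | 0 < dotv (- f2) v]) =
      ball_measure ([set v | 0 < dotv f1 v] `&` ~` [set v | 0 < dotv f2 v]).
    apply: ball_measure_ae; first exact: mI.
      by apply: measurable4I; [|apply: measurable4C]; exact: mH.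
    apply: ae4W (ae4_not_gt0 f2 f20) => v h; split => -[h1' h2'].
      by split; [exact: h1'|exact/(proj2 h)].
    by split; [exact: h1'|exact/(proj1 h)].
  rewrite -h2 -h1; apply: (congr1 ball_measure).
  by apply/seteqP; split => v; rewrite /= k1 k2.
rewrite E.
by move=> h; lra.
Qed.

Let w_linear x : 0 <= x < pi -> w x = M * x / (2 * pi).
Proof.
have p2 : 2 * (pi / 2) = pi :> R by field.
move=> hx; rewrite (bounded_additive_linear w (pi / 2) M) ?p2 //.
- rewrite w_pihalf; have := pi_gt0 R; move: (pi : R) => p p0.
  by field; rewrite gt_eqF.
- by rewrite divr_gt0 ?pi_gt0.
move=> a _; rewrite ger0_norm; last exact: ball_measure_ge0.
have := ball_measure_split [set: 'rV[R]_4] (slice 0 a) measurable4T (msb_slice _ _).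
by rewrite setTI -/M -/(w a) => ->; rewrite lerDl ball_measure_ge0.
Qed.

Lemma ball_measure_wedge_frame x : 0 <= x < pi ->
  ball_measure ([set v | 0 < dotv f1 v] `&` [set v | 0 < dotv (cos x *: f1 + sin x *: f2) v])
  = M / 2 - M * x / (2 * pi).
Proof.
move=> hx; have d0 : dir 0 = f1 by rewrite /dir cos0 sin0 scale1r scale0r addr0.
have mH := @measurable4_dotv_gt0 R.
have := ball_measure_split [set v | 0 < dotv f1 v] [set v | 0 < dotv (dir x) v]
  (mH _) (mH _).
rewrite ball_measure_half ?f_neq0 // -/M => ->.
have <- := w_linear x hx; rewrite /w /slice d0; ring.
Qed.

End wedge.

(** Gram-Schmidt reduces to an orthonormal frame: [n2 / a2] is [dir (acos c)] in the frame that
    starts with [n1 / a1]. The strict bounds on [c] make the sine used as divisor positive. *)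
Lemma ball_measure_wedge {R : realType} (n1 n2 : 'rV[R]_4) (a1 a2 : R) :
  let c := dotv n1 n2 / (a1 * a2) in
  0 < a1 -> 0 < a2 -> dotv n1 n1 = a1 ^+ 2 -> dotv n2 n2 = a2 ^+ 2 -> -1 < c < 1 ->
  ball_measure ([set v | 0 < dotv n1 v] `&` [set v | 0 < dotv n2 v]) =
  ball_measure [set: 'rV[R]_4] / 2 - ball_measure [set: 'rV[R]_4] * acos c / (2 * pi).
Proof.
move=> c a10 a20 n11 n22 /andP[c1 c2].
have c_itv : -1 <= c <= 1 by rewrite !ltW.
pose s := sin (acos c).
have sE : s ^+ 2 = 1 - c ^+ 2.
  by rewrite /s sin2cos2 acosK // in_itv.
have s0 : 0 < s.
  by apply: sin_gt0_pi; rewrite acos_gt0 ?acos_ltpi // ?c1 ?c2 ?andbT ltW.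
have cE : dotv n1 n2 = c * (a1 * a2) by rewrite /c divfK // mulf_neq0 // gt_eqF.
clearbody s; move: c c1 c2 c_itv sE cE => c c1 c2 c_itv sE cE.
have a1n : a1 != 0 by rewrite gt_eqF.
have a2n : a2 != 0 by rewrite gt_eqF.
have sn : s != 0 by rewrite gt_eqF.
have [f1 f1E] : exists f1, f1 = a1^-1 *: n1 by eexists.
have [f2 f2E] : exists f2, f2 = s^-1 *: (a2^-1 *: n2 - c *: f1) by eexists.
have f11 : dotv f1 f1 = 1 by rewrite f1E dotvZl dotvZr n11; field.
have f1n2 : dotv f1 n2 = c * a2 by rewrite f1E dotvZl cE; field.
have f12 : dotv f1 f2 = 0.
  by rewrite f2E dotvZr dotvBr !dotvZr f11 f1n2; field; rewrite sn a2n.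
have f22 : dotv f2 f2 = 1.
  rewrite {1}f2E dotvZl dotvBl !dotvZl f12 mulr0 subr0 dotvC.
  rewrite f2E dotvZl dotvBl !dotvZl n22 f1n2.
  apply: (mulfI (expf_neq0 2 sn)); rewrite mulr1 [RHS]sE.
  by field; rewrite sn a2n.
have hc : 0 <= acos c < pi by rewrite acos_ge0 // acos_ltpi // c1 ltW.
have <- := ball_measure_wedge_frame f1 f2 f11 f22 f12 (acos c) hc.
apply: (congr1 ball_measure); apply/seteqP.
have e1 v : dotv f1 v = a1^-1 * dotv n1 v by rewrite f1E dotvZl.
have e2 : cos (acos c) *: f1 + sin (acos c) *: f2 = a2^-1 *: n2.
  rewrite acosK ?in_itv // sin_acos // -sE sqrtr_sqr ger0_norm ?ltW //.
  by rewrite f2E scalerA divff // scale1r addrC subrK.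
by rewrite e2; split => v; rewrite /= e1 !dotvZl !pmulr_rgt0 ?invr_gt0.
Qed.

Lemma indicI_mul {R : pzRingType} {T : Type} (A B : set T) (x : T) :
  \1_(A `&` B) x = \1_A x * \1_B x :> R.
Proof. by rewrite !indicE in_setI; do 2! case: (_ \in _); rewrite ?mulr1 ?mulr0. Qed.

(** For indicators, adding [A B C] to the expansion of [(1 - A) (1 - B) (1 - C)] cancels the cubic
    term, so only pairwise intersections remain. *)
Lemma ball_measure_complements {R : realType} (A B C A' B' C' : set 'rV[R]_4) :
  measurable4 A -> measurable4 B -> measurable4 C ->
  measurable4 A' -> measurable4 B' -> measurable4 C' ->
  ae4 (fun v => (~ A v <-> A' v) /\ (~ B v <-> B' v) /\ (~ C v <-> C' v)) ->
  ball_measure (A `&` B `&` C) + ball_measure (A' `&` B' `&` C') =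
  ball_measure [set: 'rV[R]_4] - ball_measure A - ball_measure B - ball_measure C
  + ball_measure (A `&` B) + ball_measure (A `&` C) + ball_measure (B `&` C).
Proof.
move=> mA mB mC mA' mB' mC' h.
have := @ball_measure_comb R [:: (1, A `&` B `&` C); (1, A' `&` B' `&` C');
  (1, A); (1, B); (1, C); (-1, A `&` B); (-1, A `&` C); (-1, B `&` C)] 1.
rewrite !big_cons big_nil /=.
move=> comb; suff : 1 * ball_measure (A `&` B `&` C) +
  (1 * ball_measure (A' `&` B' `&` C') + (1 * ball_measure A + (1 * ball_measure B +
  (1 * ball_measure C + (- 1 * ball_measure (A `&` B) + (- 1 * ball_measure (A `&` C) +
  (- 1 * ball_measure (B `&` C) + 0))))))) = 1 * ball_measure [set: 'rV[R]_4].
  move: (ball_measure (A `&` B `&` C)) (ball_measure (A' `&` B' `&` C'))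
    (ball_measure (A `&` B)) (ball_measure (A `&` C)) (ball_measure (B `&` C))
    (ball_measure A) (ball_measure B) (ball_measure C) (ball_measure setT).
  move=> x1 x2 x3 x4 x5 x6 x7 x8 x9; rewrite !mul1r !mulN1r addr0 => e.
  by rewrite -e; ring.
apply: comb.
  by move=> p [<-|[<-|[<-|[<-|[<-|[<-|[<-|[<-|[]]]]]]]]]; rewrite /=; repeat apply: measurable4I.
apply: ae4W h => v [hA [hB hC]]; rewrite !big_cons big_nil /= !indicI_mul.
have e (X X' : set 'rV[R]_4) : (~ X v <-> X' v) -> \1_X' v = 1 - \1_X v :> R.
  move=> hX; rewrite !indicE (_ : (v \in X') = ~~ (v \in X)).
    by case: (v \in X); rewrite ?subrr ?subr0.
  apply/idP/idP => [|/negP]; rewrite !inE; last by move/hX.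
  by move=> vX; apply/negP; rewrite inE; exact/hX.
by rewrite (e _ _ hA) (e _ _ hB) (e _ _ hC); ring.
Qed.

(* Girard's formula: inclusion-exclusion for three half-spaces, whose intersection
   is congruent to that of the opposite ones. *)
Lemma ball_measure_three_halfspaces {R : realType} (n1 n2 n3 : 'rV[R]_4) :
  n1 != 0 -> n2 != 0 -> n3 != 0 ->
  let H n := [set v : 'rV[R]_4 | 0 < dotv n v] in
  2 * ball_measure (H n1 `&` H n2 `&` H n3) =
  ball_measure (H n1 `&` H n2) + ball_measure (H n1 `&` H n3)
   + ball_measure (H n2 `&` H n3) - ball_measure [set: 'rV[R]_4] / 2.
Proof.
move=> n10 n20 n30 H.
have mH n : measurable4 (H n) := measurable4_dotv_gt0 n.
have opp : ball_measure (H (- n1) `&` H (- n2) `&` H (- n3)) =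
    ball_measure (H n1 `&` H n2 `&` H n3).
  have QQ : (- 1%:M : 'M[R]_4) *m (- 1%:M)^T = 1%:M.
    by rewrite linearN /= trmx1 mulNmx mulmxN opprK mulmx1.
  have mI : measurable4 (H n1 `&` H n2 `&` H n3) by apply: measurable4I; [apply: measurable4I|].
  apply: etrans _ (ball_measure_orthogonal _ _ QQ mI).
  apply: (congr1 ball_measure); apply/seteqP.
  have e n v : dotv n (v *m - 1%:M) = dotv (- n) v.
    by rewrite mulmxN mulmx1 -!scaleN1r dotvZr dotvZl.
  by split => v; rewrite /H /= !e.
have := ball_measure_complements _ _ _ _ _ _ (mH n1) (mH n2) (mH n3)
  (mH (- n1)) (mH (- n2)) (mH (- n3))
  (ae4I _ _ (ae4_not_gt0 _ n10) (ae4I _ _ (ae4_not_gt0 _ n20) (ae4_not_gt0 _ n30))).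
have := ball_measure_half n1 n10; have := ball_measure_half n2 n20.
have := ball_measure_half n3 n30; rewrite -/(H n1) -/(H n2) -/(H n3) {}opp.
move: (ball_measure (H n1)) (ball_measure (H n2)) (ball_measure (H n3))
  (ball_measure (H n1 `&` H n2)) (ball_measure (H n1 `&` H n3))
  (ball_measure (H n2 `&` H n3)) (ball_measure setT)
  (ball_measure (H n1 `&` H n2 `&` H n3)) => x1 x2 x3 x4 x5 x6 x7 x8; lra.
Qed.

Lemma dotv_vec4 {R : realType} (a b c d a' b' c' d' : R) :
  dotv (vec4 a b c d) (vec4 a' b' c' d') = a * a' + b * b' + c * c' + d * d'.
Proof. by rewrite dotvE sum_I4 !mxE. Qed.

(** * Volumes of the tetrahedra on the diagonal *)

Section axis_tetrahedron.
Context {R : realType} (c s P A Q B : R).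
Hypotheses (c0 : 0 < c) (s0 : 0 < s) (A0 : A != 0) (B0 : B != 0).

Definition axis_tetrahedron : 'M[R]_4 :=
  rows4 (vec4 c 0 s 0) (vec4 c 0 (- s) 0) (vec4 P A 0 0) (vec4 0 0 Q B).

(** Inner normals of the tetrahedron up to the positive factors listed in [N]. The signs of [A] and
    [B] are built into [n3] and [n4], which makes these factors positive. *)
Let n1 : 'rV[R]_4 := vec4 c^-1 (- (P / (c * A))) s^-1 (- (Q / (s * B))).
Let n2 : 'rV[R]_4 := vec4 c^-1 (- (P / (c * A))) (- s^-1) (Q / (s * B)).
Let n3 : 'rV[R]_4 := vec4 0 A 0 0.
Let n4 : 'rV[R]_4 := vec4 0 0 0 B.

Let N := rows4 (2^-1 *: n1) (2^-1 *: n2) (A ^- 2 *: n3) (B ^- 2 *: n4).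

Let cn : c != 0. Proof. by rewrite gt_eqF. Qed.
Let sn : s != 0. Proof. by rewrite gt_eqF. Qed.

Let mulCN : axis_tetrahedron *m N^T = 1%:M.
Proof.
suff h i j : dotv (row i axis_tetrahedron) (row j N) = (i == j)%:R.
  by apply/matrixP => i j; rewrite -dotv_row h mxE.
move: i; apply: forall_I4; move: j; apply: forall_I4;
  rewrite !row_rows4 dotvZr dotv_vec4 /=; field; rewrite ?cn ?sn ?A0 ?B0 //.
Qed.

Lemma axis_tetrahedron_unit : axis_tetrahedron \in unitmx.
Proof. by have [] := mulmx1_unit mulCN. Qed.

Let facetE i : facet axis_tetrahedron i = row i N.
Proof.
have -> : N = (invmx axis_tetrahedron)^T.
  by rewrite -[invmx _]mulmx1 -mulCN mulKmx ?trmxK // axis_tetrahedron_unit.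
by rewrite /facet tr_col.
Qed.

Lemma facet_axis_tetrahedron v :
  (dotv (facet axis_tetrahedron 2%:R) v = v 0 1 / A) *
  (dotv (facet axis_tetrahedron 3%:R) v = v 0 3%:R / B).
Proof.
rewrite !facetE !row_rows4 !dotvZl !dotvE !sum_I4 !mxE /=.
by split; field; rewrite ?A0 ?B0.
Qed.

Let H n := [set v : 'rV[R]_4 | 0 < dotv n v].

Let open_coneE : open_cone axis_tetrahedron = (H n1 `&` H n2 `&` H n3) `&` H n4.
Proof.
have pos (k : R) n v : 0 < k -> (0 < dotv (k *: n) v) = (0 < dotv n v).
  by move=> k0; rewrite dotvZl pmulr_rgt0.
have A2 : 0 < A ^- 2 by rewrite invr_gt0 lt_neqAle sqr_ge0 eq_sym expf_neq0.
have B2 : 0 < B ^- 2 by rewrite invr_gt0 lt_neqAle sqr_ge0 eq_sym expf_neq0.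
have h2 : 0 < 2^-1 :> R by rewrite invr_gt0.
apply/seteqP; split => v.
  move=> h; do !split; rewrite /H /=.
  - by have := h 0; rewrite facetE row_rows4 pos.
  - by have := h 1; rewrite facetE row_rows4 pos.
  - by have := h 2%:R; rewrite facetE row_rows4 pos.
  - by have := h 3%:R; rewrite facetE row_rows4 pos.
move=> [[[h1 h2'] h3] h4]; apply: forall_I4; rewrite facetE row_rows4 pos //.
Qed.

Let mH n : measurable4 (H n). Proof. exact: measurable4_dotv_gt0. Qed.

(* The symmetry [diag(1, 1, -1, -1)] exchanges the first two facets and preserves
   the third one, hence halves the trihedral region that they bound. *)
Let open_cone_half :
  2 * ball_measure (open_cone axis_tetrahedron) = ball_measure (H n1 `&` H n2 `&` H n3).
Proof.
pose K := H n1 `&` H n2 `&` H n3.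
have mK : measurable4 K by apply: measurable4I; [apply: measurable4I|]; exact: mH.
pose D : 'M[R]_4 := diag_mx (vec4 1 1 (-1) (-1)).
have DD : D *m D^T = 1%:M.
  rewrite /D tr_diag_mx mulmx_diag (_ : \row_j _ = const_mx 1) ?diag_const_mx //.
  by apply/rowP; apply: forall_I4; rewrite !mxE /= ?mulrNN mulr1.
have dotD a b x y v : dotv (vec4 a b x y) (v *m D) = dotv (vec4 a b (- x) (- y)) v.
  by rewrite dotvC dotv_mulmx tr_diag_mx dotvC; congr dotv; apply/rowP;
    apply: forall_I4; rewrite mul_mx_diag !mxE /=; ring.
have n40 : n4 != 0 by rewrite -dotv_eq0 dotv_vec4 !mulr0 !add0r mulf_neq0.
have := ball_measure_split K (H n4) mK (mH n4); rewrite -/K => ->.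
rewrite open_coneE -/K.
have e1 : ball_measure (K `&` ~` H n4) = ball_measure (K `&` H (- n4)).
  apply: ball_measure_ae.
  - by apply: measurable4I => //; apply: measurable4C; exact: mH.
  - by apply: measurable4I => //; exact: mH.
  apply: ae4W (ae4_not_gt0 n4 n40) => v h; split => -[h1 h2].
    by split; [exact: h1|exact/(proj1 h)].
  by split; [exact: h1|exact/(proj2 h)].
have mKH : measurable4 (K `&` H n4) by apply: measurable4I => //; exact: mH.
have e2 : ball_measure (K `&` H (- n4)) = ball_measure (K `&` H n4).
  apply: etrans _ (ball_measure_orthogonal D (K `&` H n4) DD mKH).
  apply: (congr1 ball_measure).
  have k1 v : dotv n1 (v *m D) = dotv n2 v by rewrite dotD opprK.
  have k2 v : dotv n2 (v *m D) = dotv n1 v by rewrite dotD opprK.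
  have k3 v : dotv n3 (v *m D) = dotv n3 v by rewrite dotD oppr0.
  have k4 v : dotv n4 (v *m D) = dotv (- n4) v.
    rewrite dotD oppr0; congr dotv.
    by apply/rowP; apply: forall_I4; rewrite !mxE /= ?oppr0.
  by apply/seteqP; split => v; rewrite /K /H /= k1 k2 k3 k4 => -[[[? ?] ?] ?].
by rewrite e1 e2 mulr2n mulrDl mul1r.
Qed.

Let G1 := c ^- 2 + (P / (c * A)) ^+ 2.
Let G2 := s ^- 2 + (Q / (s * B)) ^+ 2.

(** [n1] and [n2] have squared length [G1 + G2] and product [G1 - G2], and both make the same angle
    with [n3], whence the coefficient [2]. The factor [8] collects the halving by symmetry, the [2]
    of Girard's formula and the [2] in the wedge measures. *)
Lemma ball_measure_axis_tetrahedron :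
  8 * ball_measure (open_cone axis_tetrahedron) =
  ball_measure [set: 'rV[R]_4] * 
   (2 - (acos ((G1 - G2) / (G1 + G2)) + 2 * acos (- (P / c) / (Num.sqrt (G1 + G2) * `|A|))) / pi).
Proof.
have G10 : 0 < G1 by rewrite ltr_pwDl ?sqr_ge0 // invr_gt0 exprn_gt0.
have G20 : 0 < G2 by rewrite ltr_pwDl ?sqr_ge0 // invr_gt0 exprn_gt0.
have G0 : 0 < G1 + G2 by apply: addr_gt0.
have sG : 0 < Num.sqrt (G1 + G2) by rewrite sqrtr_gt0.
have aA : 0 < `|A| by rewrite normr_gt0.
have h12 : -1 < (G1 - G2) / (G1 + G2) < 1.
  move: (G1) (G2) G10 G20 => x y x0 y0; have xy0 : 0 < x + y by rewrite addr_gt0.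
  by rewrite ltr_pdivlMr // ltr_pdivrMr //; apply/andP; split; lra.
have h13 : -1 < - (P / c) / (Num.sqrt (G1 + G2) * `|A|) < 1.
  rewrite -ltr_norml -(@ltr_pXn2r _ 2) ?nnegrE // expr1n real_normK ?num_real //.
  rewrite expr_div_n sqrrN [X in _ / X]exprMn sqr_sqrtr ?ltW // real_normK ?num_real //.
  rewrite ltr_pdivrMr; last by rewrite mulr_gt0 // lt_neqAle sqr_ge0 eq_sym expf_neq0.
  rewrite mul1r /G1.
  have -> : (c ^- 2 + (P / (c * A)) ^+ 2 + G2) * A ^+ 2 =
     (P / c) ^+ 2 + (c ^- 2 + G2) * A ^+ 2 by field; rewrite cn A0.
  rewrite ltrDl mulr_gt0 //; last by rewrite lt_neqAle sqr_ge0 eq_sym expf_neq0.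
  by rewrite addr_gt0 // invr_gt0 exprn_gt0.
have n11 : dotv n1 n1 = Num.sqrt (G1 + G2) ^+ 2.
  by rewrite sqr_sqrtr ?ltW // dotv_vec4 /G1 /G2; field; rewrite cn sn A0 B0.
have n22 : dotv n2 n2 = Num.sqrt (G1 + G2) ^+ 2.
  by rewrite sqr_sqrtr ?ltW // dotv_vec4 /G1 /G2; field; rewrite cn sn A0 B0.
have n33 : dotv n3 n3 = `|A| ^+ 2.
  by rewrite real_normK ?num_real // dotv_vec4; ring.
have n12 : dotv n1 n2 = G1 - G2.
  by rewrite dotv_vec4 /G1 /G2; field; rewrite cn sn A0 B0.
have n13 : dotv n1 n3 = - (P / c).
  by rewrite dotv_vec4; field; rewrite cn sn A0 B0.
have n23 : dotv n2 n3 = - (P / c).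
  by rewrite dotv_vec4; field; rewrite cn sn A0 B0.
have w12 := ball_measure_wedge n1 n2 _ _ sG sG n11 n22.
have w13 := ball_measure_wedge n1 n3 _ _ sG aA n11 n33.
have w23 := ball_measure_wedge n2 n3 _ _ sG aA n22 n33.
rewrite n12 -expr2 sqr_sqrtr in w12; last exact: ltW.
rewrite n13 in w13; rewrite n23 in w23.
have nz n a : 0 < a -> dotv n n = a ^+ 2 -> n != 0 :> 'rV[R]_4.
  by move=> a0 e; rewrite -dotv_eq0 e expf_neq0 // gt_eqF.
have := ball_measure_three_halfspaces n1 n2 n3 (nz _ _ sG n11) (nz _ _ sG n22) (nz _ _ aA n33).
rewrite /= (w12 h12) (w13 h13) (w23 h13) -/(H n1) -/(H n2) -/(H n3) -open_cone_half.
have := pi_gt0 R; move: (pi : R) => p p0.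
move: (ball_measure (open_cone _)) (ball_measure setT) (acos _) (acos _) => x m a1 a2 e.
have -> : 8 * x = 2 * (2 * (2 * x)) by ring.
by rewrite e; field; rewrite gt_eqF.
Qed.

End axis_tetrahedron.

(** The determinant is compared with one reference tetrahedron depending only on [c] and [s], so the
    orientations of the four diagonal tetrahedra differ by the signs of [A] and [B] alone. *)
Lemma det_axis_tetrahedron {R : realType} (c s P A Q B : R) :
  0 < c -> 0 < s -> A != 0 -> B != 0 ->
  \det (axis_tetrahedron c s P A Q B) = A * B * \det (axis_tetrahedron c s 0 1 0 1).
Proof.
move=> c0 s0 A0 B0; have one0 := oner_neq0 R.
have u1 := axis_tetrahedron_unit c s 0 1 0 1 c0 s0 one0 one0.
have u2 := axis_tetrahedron_unit c s P A 0 1 c0 s0 A0 one0.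
have <- : replace_row (axis_tetrahedron c s P A 0 1) 3%:R (vec4 0 0 Q B) =
    axis_tetrahedron c s P A Q B by rewrite replace_rows4.
rewrite det_replace_row // facet_axis_tetrahedron // mxE /= divr1.
have <- : replace_row (axis_tetrahedron c s 0 1 0 1) 2%:R (vec4 P A 0 0) =
    axis_tetrahedron c s P A 0 1 by rewrite replace_rows4.
rewrite det_replace_row // facet_axis_tetrahedron // mxE /= divr1.
by rewrite mulrCA mulrA.
Qed.

(** The sum of the three angles between the normals of the trihedral region. For the flexible
    octahedron [G1] and [G2] simplify to [K^-1] and [L^-1], and [D = K + L]. *)
Definition axis_angles {R : realType} (p q t : R) : R :=
  let K := cos t ^+ 2 - p ^+ 2 in let L := sin t ^+ 2 - q ^+ 2 in
  let D := 1 - p ^+ 2 - q ^+ 2 in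
  acos ((L - K) / D) + 2 * acos (- (p / cos t) * Num.sqrt (L / D)).

Lemma sqr_lt_norm {R : realDomainType} (p c : R) : `|p| < c -> p ^+ 2 < c ^+ 2.
Proof.
move=> pc; rewrite -(real_normK (num_real p)) ltr_pXn2r // ?nnegrE //.
exact: le_trans (normr_ge0 p) (ltW pc).
Qed.

Lemma ball_measure_flexible_tetrahedron {R : realType} (p q t d e : R) :
  `|p| < cos t -> `|q| < sin t -> d ^+ 2 = 1 -> e ^+ 2 = 1 ->
  8 * ball_measure (open_cone (axis_tetrahedron (cos t) (sin t)
     (p / cos t) (d * Num.sqrt (1 - p ^+ 2 / cos t ^+ 2))
     (q / sin t) (e * Num.sqrt (1 - q ^+ 2 / sin t ^+ 2)))) =
  ball_measure [set: 'rV[R]_4] * (2 - axis_angles p q t / pi).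
Proof.
have cs := cos2Dsin2 t; rewrite /axis_angles; move: (cos t) (sin t) cs => c s cs pc qs dd ee.
have c0 : 0 < c := le_lt_trans (normr_ge0 p) pc.
have s0 : 0 < s := le_lt_trans (normr_ge0 q) qs.
have K0 := sqr_lt_norm _ _ pc; have L0 := sqr_lt_norm _ _ qs.
rewrite -subr_gt0 in K0; rewrite -subr_gt0 in L0.
have DE : 1 - p ^+ 2 - q ^+ 2 = (c ^+ 2 - p ^+ 2) + (s ^+ 2 - q ^+ 2) by rewrite -cs; ring.
have cn : c != 0 by rewrite gt_eqF.
have sn : s != 0 by rewrite gt_eqF.
have a2 : 1 - p ^+ 2 / c ^+ 2 = (c ^+ 2 - p ^+ 2) / c ^+ 2 by field.
have b2 : 1 - q ^+ 2 / s ^+ 2 = (s ^+ 2 - q ^+ 2) / s ^+ 2 by field.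
have A2 : 0 < 1 - p ^+ 2 / c ^+ 2 by rewrite a2 divr_gt0 // exprn_gt0.
have B2 : 0 < 1 - q ^+ 2 / s ^+ 2 by rewrite b2 divr_gt0 // exprn_gt0.
have d0 : d != 0 by apply: contraTneq (oner_neq0 R) => d0; rewrite -dd d0 expr0n eqxx.
have e0 : e != 0 by apply: contraTneq (oner_neq0 R) => e0; rewrite -ee e0 expr0n eqxx.
have An : d * Num.sqrt (1 - p ^+ 2 / c ^+ 2) != 0 by rewrite mulf_neq0 // gt_eqF // sqrtr_gt0.
have Bn : e * Num.sqrt (1 - q ^+ 2 / s ^+ 2) != 0 by rewrite mulf_neq0 // gt_eqF // sqrtr_gt0.
rewrite (ball_measure_axis_tetrahedron _ _ _ _ _ _ c0 s0 An Bn).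
congr (_ * (2 - (acos _ + 2 * acos _) / pi)).
all: have Kn : c ^+ 2 - p ^+ 2 != 0 by rewrite gt_eqF.
all: have Ln : s ^+ 2 - q ^+ 2 != 0 by rewrite gt_eqF.
all: have G1 : c ^- 2 + (p / c / (c * (d * Num.sqrt (1 - p ^+ 2 / c ^+ 2)))) ^+ 2 =
    (c ^+ 2 - p ^+ 2)^-1 by
  rewrite !exprMn !exprVn !exprMn dd sqr_sqrtr ?ltW // a2; field; rewrite cn Kn.
all: have G2 : s ^- 2 + (q / s / (s * (e * Num.sqrt (1 - q ^+ 2 / s ^+ 2)))) ^+ 2 =
    (s ^+ 2 - q ^+ 2)^-1 by
  rewrite !exprMn !exprVn !exprMn ee sqr_sqrtr ?ltW // b2; field; rewrite sn Ln.
all: rewrite G1 G2 DE.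
all: move: (c ^+ 2 - p ^+ 2) (s ^+ 2 - q ^+ 2) K0 L0 Kn Ln a2 => K L K0 L0 Kn Ln a2.
all: have KLn : K + L != 0 by rewrite gt_eqF ?addr_gt0.
  by field; rewrite Kn Ln KLn.
have d1 : `|d| = 1.
  by apply/eqP; rewrite -(@eqrXn2 _ 2) ?normr_ge0 // real_normK ?num_real // dd expr1n.
rewrite normrM d1 mul1r (ger0_norm (sqrtr_ge0 _)) a2.
have -> : K^-1 + L^-1 = (K + L) / (K * L) by field; rewrite Kn Ln.
have E : Num.sqrt ((K + L) / (K * L)) * Num.sqrt (K / c ^+ 2) = (Num.sqrt (L / (K + L)))^-1 / c.
  have -> : (Num.sqrt (L / (K + L)))^-1 / c = Num.sqrt ((K + L) / L / c ^+ 2).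
    rewrite [RHS]sqrtrM; last by rewrite divr_ge0 ?addr_ge0 ?ltW.
    by rewrite sqrtrV ?sqr_ge0 // sqrtr_sqr (ger0_norm (ltW c0)) -sqrtrV ?invf_div //
      divr_ge0 ?addr_ge0 ?ltW.
  rewrite -sqrtrM; last by rewrite divr_ge0 ?addr_ge0 ?mulr_ge0 ?ltW.
  by congr Num.sqrt; field; rewrite cn Kn Ln.
rewrite E; field; rewrite cn /= gt_eqF // sqrtr_gt0 divr_gt0 // addr_gt0 //.
Qed.

(** * The volume of the flexible octahedron as an alternating sum of angles *)

Section flexible.
Context {R : realType} (p1 p2 q1 q2 t d1 d2 e1 e2 : R).
Hypotheses (p1t : `|p1| < cos t) (p2t : `|p2| < cos t)
  (q1t : `|q1| < sin t) (q2t : `|q2| < sin t)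
  (d1s : is_sign d1) (d2s : is_sign d2) (e1s : is_sign e1) (e2s : is_sign e2).

Let P0 := flexible_octahedron p1 p2 q1 q2 t d1 d2 e1 e2.
Let p b := if b then p2 else p1.
Let q b := if b then q2 else q1.
Let d b := if b then d2 else d1.
Let e b := if b then e2 else e1.

Let pt b : `|p b| < cos t. Proof. by case: b. Qed.
Let qt b : `|q b| < sin t. Proof. by case: b. Qed.
Let ds b : is_sign (d b). Proof. by case: b. Qed.
Let es b : is_sign (e b). Proof. by case: b. Qed.

Let sign_sqr (x : R) : is_sign x -> x ^+ 2 = 1.
Proof. by case=> ->; rewrite ?sqrrN expr1n. Qed.

Let vertexE :
  (forall b, vertex P0 0 b =
     vec4 (p b / cos t) (d b * Num.sqrt (1 - p b ^+ 2 / cos t ^+ 2)) 0 0)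
  * (forall b, vertex P0 1 b = vec4 0 0 (q b / sin t) (e b * Num.sqrt (1 - q b ^+ 2 / sin t ^+ 2)))
  * (vertex P0 2%:R false = vec4 (cos t) 0 (sin t) 0)
  * (vertex P0 2%:R true = vec4 (cos t) 0 (- sin t) 0).
Proof. by split; [split; [split => -[]|]|]; rewrite /vertex rowK. Qed.

Let axisE b0 b1 : rows4 (vertex P0 2%:R false) (vertex P0 2%:R true) (vertex P0 0 b0)
    (vertex P0 1 b1) = axis_tetrahedron (cos t) (sin t)
   (p b0 / cos t) (d b0 * Num.sqrt (1 - p b0 ^+ 2 / cos t ^+ 2))
   (q b1 / sin t) (e b1 * Num.sqrt (1 - q b1 ^+ 2 / sin t ^+ 2)).
Proof. by rewrite !vertexE. Qed.

Let c0 : 0 < cos t := le_lt_trans (normr_ge0 p1) p1t.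
Let s0 : 0 < sin t := le_lt_trans (normr_ge0 q1) q1t.

Let sqrt_gt0 (x c : R) : `|x| < c -> 0 < Num.sqrt (1 - x ^+ 2 / c ^+ 2).
Proof.
move=> xc; have cc := le_lt_trans (normr_ge0 x) xc.
by rewrite sqrtr_gt0 subr_gt0 ltr_pdivrMr ?exprn_gt0 // mul1r sqr_lt_norm.
Qed.

Let sign_neq0 (x : R) : is_sign x -> x != 0.
Proof. by case=> ->; rewrite ?oppr_eq0 oner_eq0. Qed.

Let An b : d b * Num.sqrt (1 - p b ^+ 2 / cos t ^+ 2) != 0.
Proof. by rewrite mulf_neq0 //; [exact/sign_neq0/ds|rewrite gt_eqF // sqrt_gt0]. Qed.

Let Bn b : e b * Num.sqrt (1 - q b ^+ 2 / sin t ^+ 2) != 0.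
Proof. by rewrite mulf_neq0 //; [exact/sign_neq0/es|rewrite gt_eqF // sqrt_gt0]. Qed.

Lemma flexible_axis_unit b0 b1 : rows4 (vertex P0 2%:R false) (vertex P0 2%:R true)
  (vertex P0 0 b0) (vertex P0 1 b1) \in unitmx.
Proof. by rewrite axisE; apply: axis_tetrahedron_unit. Qed.

Let sg_sign (x : R) : is_sign x -> Num.sg x = x.
Proof. by case=> ->; rewrite ?sgrN sgr1. Qed.

(** [k] is the sign of the reference determinant. It is common to the four tetrahedra and can stay
    unknown, since a global sign at most doubles the list of levels. *)
Lemma flexible_tvol : exists2 k : R, is_sign k & forall b0 b1,
  tvol (vertex P0 2%:R false) (vertex P0 2%:R true) (vertex P0 0 b0) (vertex P0 1 b1)
  = k * (d b0 * e b1 * (ball_measure [set: 'rV[R]_4] / 2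
          * (2 - axis_angles (p b0) (q b1) t / pi))).
Proof.
exists (Num.sg (\det (axis_tetrahedron (cos t) (sin t) 0 1 0 1))).
  have u : axis_tetrahedron (cos t) (sin t) 0 1 0 1 \in unitmx.
    by apply: axis_tetrahedron_unit => //; exact: oner_neq0.
  move: u; rewrite unitmxE unitfE => u.
  move: u; move: (\det _) => x x0; have := x0.
  by case: sgrP => // _ _; [left|right].
move=> b0 b1; rewrite tvolE tetrahedron_oriented_volumeE; last exact: flexible_axis_unit.
rewrite axisE (det_axis_tetrahedron _ _ _ _ _ _ c0 s0 (An b0) (Bn b1)).
have := ball_measure_flexible_tetrahedron _ _ _ _ _ (pt b0) (qt b1) (sign_sqr _ (ds b0))
  (sign_sqr _ (es b1)).
move: (ball_measure (open_cone _)) => x hx.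
rewrite !sgrM (gtr0_sg (sqrt_gt0 _ _ (pt b0))) (gtr0_sg (sqrt_gt0 _ _ (qt b1))) !mulr1.
rewrite (sg_sign _ (ds b0)) (sg_sign _ (es b1)).
have -> : 4 * x = (8 * x) / 2 by field.
rewrite hx; move: (axis_angles _ _ _ / pi) (Num.sg _) (ball_measure _) => y z m.
by field.
Qed.

Definition axis_sum : R := \sum_b0 \sum_b1 (-1) ^+ (b0 (+) b1) *
  (d b0 * e b1 * (ball_measure [set: 'rV[R]_4] / 2
    * (2 - axis_angles (p b0) (q b1) t / pi))).

Lemma vertex_mulmx (Q : 'M[R]_4) i b :
  vertex (P0.1 *m Q, P0.2 *m Q) i b = vertex P0 i b *m Q.
Proof. by rewrite /vertex; case: b; rewrite row_mul. Qed.

(** The volume of a class is computed on [repr x], a rotated copy of the given octahedron, with an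
    apex of its own. Once this volume is expressed by diagonal tetrahedra the apex is gone, and
    these are rotation invariant. *)
Lemma flexible_class_volume (x : octahedron_class R) :
  x = \pi_(octahedron_class R)%qT P0 ->
  exists y k : R, [/\ class_oriented_volume x = \pi_({ideal_quot @volume_periods R})%qT y,
    is_sign k & y + k * axis_sum \in @full_turns R].
Proof.
move=> xP; have : congruent P0 (repr x).
  by apply/(@eqmodP _ (congruent_equiv R)); rewrite -xP reprK.
move=> /asboolP[Q [rQ PQ]].
pose PR := repr x.
have uQ : Q \in unitmx by rewrite unitmxE rQ.2 unitr1.
have axisQ b0 b1 : rows4 (vertex PR 2%:R false) (vertex PR 2%:R true) (vertex PR 0 b0)
    (vertex PR 1 b1) = rows4 (vertex P0 2%:R false) (vertex P0 2%:R true) (vertex P0 0 b0)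
    (vertex P0 1 b1) *m Q.
  by rewrite /PR PQ !vertex_mulmx rows4_mulmx.
have uaxis b0 b1 : rows4 (vertex PR 2%:R false) (vertex PR 2%:R true) (vertex PR 0 b0)
    (vertex PR 1 b1) \in unitmx.
  by rewrite axisQ unitmx_mul uQ flexible_axis_unit.
have adm : admissible_apex PR (get (admissible_apex PR)).
  by have [w hw] := admissible_apex_nonempty _ uaxis; exact: getI hw.
have [k ks hk] := flexible_tvol.
exists (fan PR (get (admissible_apex PR))), k; split => //.
  by rewrite /class_oriented_volume /octahedron_oriented_volume sum_face_cones.
have := octahedron_fan_axis _ uaxis _ adm.
rewrite (_ : \sum_b0 _ = k * axis_sum) //.
rewrite /axis_sum mulr_sumr; apply: eq_bigr => b0 _; rewrite mulr_sumr.
apply: eq_bigr => b1 _; rewrite [RHS]mulrCA; congr (_ * _).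
rewrite -hk !tvolE axisQ oriented_volume_mulmx //; exact: flexible_axis_unit.
Qed.

End flexible.

(** * Level sets of the volume *)

Section derivation_rules.
Context {R : realType} (f g : R -> R) (x a b : R).
Hypotheses (df : is_derive x 1 f a) (dg : is_derive x 1 g b).

Lemma deriv_sub : is_derive x 1 (fun y => f y - g y) (a - b).
Proof. exact: is_deriveB. Qed.

Lemma deriv_add : is_derive x 1 (fun y => f y + g y) (a + b).
Proof. exact: is_deriveD. Qed.

Lemma deriv_mul : is_derive x 1 (fun y => f y * g y) (a * g x + f x * b).
Proof.
apply: is_derive_eq (is_deriveM df dg) _.
by rewrite addrC [_ *: a]mulrC.
Qed.

Lemma deriv_inv : f x != 0 -> is_derive x 1 (fun y => (f y)^-1) (- a / f x ^+ 2).
Proof.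
by move=> fx; apply: is_derive_eq (is_deriveV fx df) _; rewrite /GRing.scale /=; ring.
Qed.

End derivation_rules.

Lemma deriv_cst {R : realType} (k x : R) : is_derive x 1 (fun=> k) 0.
Proof. exact: is_derive_cst. Qed.

Lemma deriv_comp {R : realType} (f g : R -> R) (x a b : R) :
  is_derive (g x) 1 f a -> is_derive x 1 g b -> is_derive x 1 (fun y => f (g y)) (a * b).
Proof. exact: is_derive1_comp. Qed.

(** Both arccosines have arguments [x] for which [1 - x ^+ 2] is a perfect square in [k], [l], [d],
    [r], the roots of [K], [L], [D] and [1 - q ^+ 2]. In the sum of the two derivatives [d]
    disappears. *)
Lemma is_derive_axis_angles {R : realType} (p q t : R) :
  `|p| < cos t -> `|q| < sin t ->
  is_derive t 1 (axis_angles p q)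
    (- (2 * sin t * (cos t ^+ 2 - p * Num.sqrt (1 - q ^+ 2))
        / (cos t * (Num.sqrt (cos t ^+ 2 - p ^+ 2) * Num.sqrt (sin t ^+ 2 - q ^+ 2))))).
Proof.
move=> pc qs; have cs := cos2Dsin2 t.
have c0 : 0 < cos t := le_lt_trans (normr_ge0 p) pc.
have s0 : 0 < sin t := le_lt_trans (normr_ge0 q) qs.
have K0 := sqr_lt_norm _ _ pc; have L0 := sqr_lt_norm _ _ qs.
rewrite -subr_gt0 in K0; rewrite -subr_gt0 in L0.
have [D De] : exists D, D = 1 - p ^+ 2 - q ^+ 2 by eexists.
have DE : D = (cos t ^+ 2 - p ^+ 2) + (sin t ^+ 2 - q ^+ 2) by rewrite De -cs; ring.
have D0 : 0 < D by rewrite DE addr_gt0.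
have r0 : 0 < 1 - q ^+ 2 by have := sqr_ge0 (cos t); lra.
have ds := is_derive_sin t; have dc := is_derive_cos t.
have dL := deriv_sub _ _ _ _ _ (deriv_mul _ _ _ _ _ ds ds) (deriv_cst (q ^+ 2) t).
have dK := deriv_sub _ _ _ _ _ (deriv_mul _ _ _ _ _ dc dc) (deriv_cst (p ^+ 2) t).
have du := deriv_mul _ _ _ _ _ (deriv_sub _ _ _ _ _ dL dK) (deriv_cst D^-1 t).
have cn : cos t != 0 by rewrite gt_eqF.
have LD0 : 0 < (sin t * sin t - q ^+ 2) * D^-1 by rewrite -expr2 divr_gt0.
have dq := deriv_mul _ _ _ _ _ dL (deriv_cst D^-1 t).
have dr := deriv_comp Num.sqrt (fun y => (sin y * sin y - q ^+ 2) * D^-1) t _ _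
  (is_derive1_sqrt LD0) dq.
have dz := deriv_mul _ _ _ _ _ (deriv_mul _ _ _ _ _ (deriv_cst (- p) t)
  (deriv_inv _ _ _ dc cn)) dr.
set u := fun y => _ in du; set z := fun y => _ in dz.
have [k kE] : exists k, k = Num.sqrt (cos t ^+ 2 - p ^+ 2) by eexists.
have [l lE] : exists l, l = Num.sqrt (sin t ^+ 2 - q ^+ 2) by eexists.
have [d dE] : exists d, d = Num.sqrt D by eexists.
have [r rE] : exists r, r = Num.sqrt (1 - q ^+ 2) by eexists.
have k0 : 0 < k by rewrite kE sqrtr_gt0.
have l0 : 0 < l by rewrite lE sqrtr_gt0.
have d0 : 0 < d by rewrite dE sqrtr_gt0.
have r1 : 0 < r by rewrite rE sqrtr_gt0.
have kk : k ^+ 2 = cos t ^+ 2 - p ^+ 2 by rewrite kE sqr_sqrtr // ltW.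
have ll : l ^+ 2 = sin t ^+ 2 - q ^+ 2 by rewrite lE sqr_sqrtr // ltW.
have dd : d ^+ 2 = D by rewrite dE sqr_sqrtr // ltW.
have rr : r ^+ 2 = 1 - q ^+ 2 by rewrite rE sqr_sqrtr // ltW.
have dkl : d ^+ 2 = k ^+ 2 + l ^+ 2 by rewrite dd kk ll DE.
have nz : [/\ k != 0, l != 0, d != 0 & r != 0] by rewrite !gt_eqF.
have [kn ln dn rn] := nz.
have sLD : Num.sqrt ((sin t * sin t - q ^+ 2) * D^-1) = l / d.
  by rewrite -expr2 sqrtrM ?ltW // -lE sqrtrV ?ltW // -dE.
have ut : u t = (l ^+ 2 - k ^+ 2) / d ^+ 2 by rewrite /u ll kk dd; ring.
have zt : z t = - p / cos t * (l / d) by rewrite /z sLD.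
have u1 : 1 - u t ^+ 2 = (2 * k * l / d ^+ 2) ^+ 2.
  rewrite ut; apply: (mulIf (expf_neq0 4 dn)).
  have -> : (1 - ((l ^+ 2 - k ^+ 2) / d ^+ 2) ^+ 2) * d ^+ 4 =
     (d ^+ 2) ^+ 2 - (l ^+ 2 - k ^+ 2) ^+ 2 by field.
  have -> : (2 * k * l / d ^+ 2) ^+ 2 * d ^+ 4 = (2 * k * l) ^+ 2 by field.
  by rewrite dkl; ring.
have z1 : 1 - z t ^+ 2 = (r * k / (cos t * d)) ^+ 2.
  rewrite zt.
  have -> : 1 - (- p / cos t * (l / d)) ^+ 2 =
     (cos t ^+ 2 * d ^+ 2 - p ^+ 2 * l ^+ 2) / (cos t * d) ^+ 2 by field; rewrite cn dn.
  have s2 : sin t ^+ 2 = 1 - cos t ^+ 2 by rewrite -cs; ring.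
  rewrite expr_div_n; congr (_ / _).
  by rewrite exprMn rr kk ll dd De s2; ring.
have sq1 (x y : R) : 0 < y -> 1 - x ^+ 2 = y ^+ 2 -> -1 < x < 1 /\ Num.sqrt (1 - x ^+ 2) = y.
  move=> y0 xy; split; last by rewrite xy sqrtr_sqr ger0_norm // ltW.
  rewrite -ltr_norml -(@ltr_pXn2r _ 2) ?nnegrE // real_normK ?num_real // expr1n.
  by rewrite -subr_gt0 xy exprn_gt0.
have y1 : 0 < 2 * k * l / d ^+ 2 by rewrite divr_gt0 ?mulr_gt0 ?exprn_gt0.
have y2 : 0 < r * k / (cos t * d) by rewrite divr_gt0 ?mulr_gt0.
have [ui us] := sq1 _ _ y1 u1.
have [zi zs] := sq1 _ _ y2 z1.
have dau := deriv_comp (@acos R) u t _ _ (is_derive1_acos ui) du.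
have daz := deriv_comp (@acos R) z t _ _ (is_derive1_acos zi) dz.
have := deriv_add _ _ _ _ _ dau (deriv_mul _ _ _ _ _ (deriv_cst 2 t) daz).
have -> : (fun y => acos (u y) + 2 * acos (z y)) = axis_angles p q.
  apply/funext => y; rewrite /axis_angles /u /z -De !expr2.
  by congr (acos _ + 2 * acos (_ * _)); ring.
move=> h; apply: is_derive_eq h _.
rewrite us zs -kE -lE -rE sLD.
rewrite !mul0r !add0r !mulr0 !addr0 !subr0.
have -> : D = d ^+ 2 by rewrite dd.
have sc : sin t != 0 by rewrite gt_eqF.
move: kk ll rr dkl dd De; move: (cos t) (sin t) cs cn sc => c s cs cn sc kk ll rr dkl dd De.
have r2 : r ^+ 2 = l ^+ 2 + c ^+ 2 by rewrite rr ll -cs; ring.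
have -> : (c * s + s * c - (- s * c + c * - s)) / d ^+ 2 = 4 * s * c / d ^+ 2 by field.
(* The second arccosine contributes a denominator [r]. After multiplication by [r], the relation
   [r ^+ 2 = l ^+ 2 + c ^+ 2] makes both sides agree as rational functions. *)
apply: (mulIf rn).
have -> : - (2 * s * (c ^+ 2 - p * r) / (c * (k * l))) * r =
  - (2 * s * (c ^+ 2 * r - p * r ^+ 2) / (c * (k * l))) by field; rewrite cn kn ln.
rewrite [in RHS]r2.
by field; rewrite cn kn ln dn rn.
Qed.

(** * Countability of level sets by Rolle's theorem *)

Lemma ltn_count {T : eqType} (P Q : pred T) (s : seq T) (z : T) :
  (forall x, P x -> Q x) -> z \in s -> Q z -> ~~ P z -> (count P s < count Q s)%N.
Proof.
move=> PQ zs Qz nPz; elim: s zs => //= x s IH; rewrite inE => /predU1P[<-|/IH h].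
  by rewrite (negbTE nPz) Qz add0n add1n ltnS; apply: sub_count => y; exact: PQ.
by rewrite -addnS leq_add //; case: (P x) (PQ x) => // ->.
Qed.

(** Between two points [x < y] of a level Rolle gives a critical [z], and [g z] is an element of [s]
    with [g y < g z < g x]. It is counted in [N y] and not in [N x], so [N] is injective on the
    level. *)
Lemma countable_level_set {R : realType} (f df g : R -> R) (s : seq R) (a b : R) :
  (forall x, a < x < b -> is_derive x 1 f (df x)) ->
  (forall x, a < x < b -> df x = 0 -> g x \in s) ->
  (forall x y, a < x -> x < y -> y < b -> g y < g x) ->
  forall v, countable [set x | a < x < b /\ f x = v].
Proof.
move=> dff crit gdec v; apply/countable_injP.
pose N x := count (fun z => g x < z) s.
have Nlt x y : a < x -> x < y -> y < b -> f x = f y -> (N x < N y)%N.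
  move=> ax xy yb fxy.
  have der z : z \in `[x, y] -> derivable f z 1.
    rewrite in_itv /= => /andP[xz zy].
    by have [] := dff z; [rewrite (lt_le_trans ax xz) (le_lt_trans zy yb)|].
  have [z|||z] := @Rolle R f x y xy.
  - by move=> zxy; apply: der; apply: subset_itv_oo_cc zxy.
  - exact: derivable_within_continuous.
  - exact: fxy.
  rewrite in_itv /= => /andP[xz zy] dz.
  have zab : a < z < b by rewrite (lt_trans ax xz) (lt_trans zy yb).
  have dz0 : df z = 0.
    have [_ <-] := dff z zab; by case: dz.
  have zs := crit z zab dz0.
  have gxz : g z < g x by apply: gdec => //; case/andP: zab.
  have gzy : g y < g z by apply: gdec => //; case/andP: zab.
  by apply: (@ltn_count _ _ _ _ (g z)) => // [w|];
    [exact: lt_trans (lt_trans gzy gxz)|rewrite ltNge ltW].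
exists N => x y; rewrite !inE => -[/andP[ax xb] fx] [/andP[ay yb] fy] Nxy.
apply/eqP; apply: contraT; rewrite neq_lt => /orP[xy|yx].
  by have := Nlt x y ax xy yb (etrans fx (esym fy)); rewrite Nxy ltnn.
by have := Nlt y x ay yx xb (etrans fy (esym fx)); rewrite Nxy ltnn.
Qed.

Lemma poly_roots_seq {R : idomainType} (p : {poly R}) : p != 0 ->
  exists s : seq R, forall x, root p x -> x \in s.
Proof.
have [n] := ubnP (size p); elim: n p => // n IH p sp p0.
have [[a pa]|np] := pselect (exists a, root p a); last first.
  by exists [::] => x px; case: np; exists x.
have [q qE] := factor_theorem _ _ pa.
have q0 : q != 0 by apply: contraNneq p0 => q0; rewrite qE q0 mul0r.
have [|s hs] := IH q _ q0.
  move: sp; rewrite qE size_Mmonic ?monicXsubC // size_XsubC addn2 /= ltnS.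
  exact: leq_trans.
exists (a :: s) => x; rewrite qE rootM root_XsubC inE => /orP[/hs ->|->//].
by rewrite orbT.
Qed.

(* The numerator obtained from the equation
   [\sum_(i, j) +- (w - p i * r j) / (A i * B j) = 0], with [A i ^+ 2 = w - p i ^+ 2]
   and [B j ^+ 2 = r j ^+ 2 - w], by eliminating the square roots [A i] and [B j]. *)
Definition critical_poly {R : comNzRingType} (p1 p2 r1 r2 : R) : {poly R} :=
  let A p := 'X - (p ^+ 2)%:P in let B r := (r ^+ 2)%:P - 'X in
  let C p r := 'X - (p * r)%:P in
  (B r2 * (C p1 r1 ^+ 2 * A p2 + C p2 r1 ^+ 2 * A p1)
   - B r1 * (C p1 r2 ^+ 2 * A p2 + C p2 r2 ^+ 2 * A p1)) ^+ 2
  - 4%:P * (A p1 * A p2) * (B r2 * (C p1 r1 * C p2 r1) - B r1 * (C p1 r2 * C p2 r2)) ^+ 2.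

Lemma horner_critical_poly {R : comNzRingType} (p1 p2 r1 r2 w : R) :
  (critical_poly p1 p2 r1 r2).[w] =
  ((r2 ^+ 2 - w) * ((w - p1 * r1) ^+ 2 * (w - p2 ^+ 2) + (w - p2 * r1) ^+ 2 * (w - p1 ^+ 2))
   - (r1 ^+ 2 - w) * ((w - p1 * r2) ^+ 2 * (w - p2 ^+ 2) + (w - p2 * r2) ^+ 2 * (w - p1 ^+ 2))) ^+ 2
  - 4 * ((w - p1 ^+ 2) * (w - p2 ^+ 2)) *
   ((r2 ^+ 2 - w) * ((w - p1 * r1) * (w - p2 * r1))
    - (r1 ^+ 2 - w) * ((w - p1 * r2) * (w - p2 * r2))) ^+ 2.
Proof. by rewrite /critical_poly !hornerE. Qed.

(* At the larger [p i ^+ 2] the second square vanishes and the first does not. *)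
Lemma critical_poly_neq0 {R : realDomainType} (p1 p2 r1 r2 : R) :
  `|p1| != `|p2| -> r1 != r2 -> `|p1| < r1 -> `|p1| < r2 -> `|p2| < r1 -> `|p2| < r2 ->
  critical_poly p1 p2 r1 r2 != 0.
Proof.
have key (a b : R) : `|a| < `|b| -> r1 != r2 -> `|b| < r1 -> `|b| < r2 ->
    (b ^+ 2 - a ^+ 2) * (b ^+ 2 * ((r1 - b) * (r2 - b) * (2 * b * (r1 - r2)))) != 0.
  move=> ab r12 b1 b2; have b0 : b != 0 by rewrite -normr_gt0 (le_lt_trans _ ab).
  rewrite !mulf_neq0 ?expf_neq0 ?pnatr_eq0 ?subr_eq0 //.
  - rewrite gt_eqF // -(real_normK (num_real a)) -(real_normK (num_real b)).
    by rewrite ltr_pXn2r // nnegrE.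
  - by rewrite gt_eqF // (le_lt_trans (ler_norm b)).
  - by rewrite gt_eqF // (le_lt_trans (ler_norm b)).
rewrite neq_lt => /orP[p12|p21] r12 h11 h12 h21 h22.
  apply/negP => /eqP h; have := horner_critical_poly p1 p2 r1 r2 (p2 ^+ 2).
  rewrite h horner0 => /esym/eqP; apply/negP.
  rewrite (_ : _ - _ = ((p2 ^+ 2 - p1 ^+ 2) *
     (p2 ^+ 2 * ((r1 - p2) * (r2 - p2) * (2 * p2 * (r1 - r2))))) ^+ 2); last by ring.
  by rewrite expf_neq0 // key.
apply/negP => /eqP h; have := horner_critical_poly p1 p2 r1 r2 (p1 ^+ 2).
rewrite h horner0 => /esym/eqP; apply/negP.
rewrite (_ : _ - _ = ((p1 ^+ 2 - p2 ^+ 2) *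
   (p1 ^+ 2 * ((r1 - p1) * (r2 - p1) * (2 * p1 * (r1 - r2))))) ^+ 2); last by ring.
by rewrite expf_neq0 // key.
Qed.

(** Two squarings. Once the terms with [t1] and those with [t2] are on opposite sides, the first
    removes [t1], [t2] and leaves [B1], [B2] in even powers. The second follows the isolation of the
    terms with [s1 * s2 * A1 * A2], the only odd ones left. *)
Lemma critical_poly_root {R : fieldType} (p1 p2 r1 r2 w A1 A2 B1 B2 s1 s2 t1 t2 : R) :
  A1 ^+ 2 = w - p1 ^+ 2 -> A2 ^+ 2 = w - p2 ^+ 2 ->
  B1 ^+ 2 = r1 ^+ 2 - w -> B2 ^+ 2 = r2 ^+ 2 - w ->
  A1 != 0 -> A2 != 0 -> B1 != 0 -> B2 != 0 ->
  s1 ^+ 2 = 1 -> s2 ^+ 2 = 1 -> t1 ^+ 2 = 1 -> t2 ^+ 2 = 1 ->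
  s1 * t1 * ((w - p1 * r1) / (A1 * B1)) + s2 * t1 * ((w - p2 * r1) / (A2 * B1))
  + s1 * t2 * ((w - p1 * r2) / (A1 * B2)) + s2 * t2 * ((w - p2 * r2) / (A2 * B2)) = 0 ->
  root (critical_poly p1 p2 r1 r2) w.
Proof.
move=> a1 a2 b1 b2 A10 A20 B10 B20 s11 s22 t11 t22.
rewrite rootE horner_critical_poly -a1 -a2 -b1 -b2.
move: (w - p1 * r1) (w - p2 * r1) (w - p1 * r2) (w - p2 * r2) => X Y Z U e.
have {}e : t1 * (B2 * (s1 * X * A2 + s2 * Y * A1)) = - (t2 * (B1 * (s1 * Z * A2 + s2 * U * A1))).
  apply/eqP; rewrite -subr_eq0 opprK; apply/eqP.
  rewrite -[RHS](mulr0 (A1 * A2 * B1 * B2)) -e; field.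
  by rewrite A10 A20 B10 B20.
have {}e : B2 ^+ 2 * (s1 * X * A2 + s2 * Y * A1) ^+ 2 = B1 ^+ 2 * (s1 * Z * A2 + s2 * U * A1) ^+ 2.
  by have := congr1 (fun x => x ^+ 2) e; rewrite /= sqrrN !exprMn t11 t22 !mul1r.
have {}e : B2 ^+ 2 * (X ^+ 2 * A2 ^+ 2 + Y ^+ 2 * A1 ^+ 2)
    - B1 ^+ 2 * (Z ^+ 2 * A2 ^+ 2 + U ^+ 2 * A1 ^+ 2)
   = - (2 * s1 * s2 * (A1 * A2) * (B2 ^+ 2 * (X * Y) - B1 ^+ 2 * (Z * U))).
  have sq (x y z : R) : s1 ^+ 2 * x + s2 ^+ 2 * y = x + y by rewrite s11 s22 !mul1r.
  apply/eqP; rewrite -subr_eq0 opprK; apply/eqP.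
  move/eqP: e; rewrite -subr_eq0 => /eqP e.
  rewrite -[RHS]e.
  have -> : X ^+ 2 * A2 ^+ 2 = s1 ^+ 2 * (X ^+ 2 * A2 ^+ 2) by rewrite s11 mul1r.
  have -> : Y ^+ 2 * A1 ^+ 2 = s2 ^+ 2 * (Y ^+ 2 * A1 ^+ 2) by rewrite s22 mul1r.
  have -> : Z ^+ 2 * A2 ^+ 2 = s1 ^+ 2 * (Z ^+ 2 * A2 ^+ 2) by rewrite s11 mul1r.
  have -> : U ^+ 2 * A1 ^+ 2 = s2 ^+ 2 * (U ^+ 2 * A1 ^+ 2) by rewrite s22 mul1r.
  by ring.
rewrite e sqrrN; apply/eqP.
have -> : (2 * s1 * s2 * (A1 * A2) * (B2 ^+ 2 * (X * Y) - B1 ^+ 2 * (Z * U))) ^+ 2 =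
  s1 ^+ 2 * s2 ^+ 2 * (4 * (A1 ^+ 2 * A2 ^+ 2) * (B2 ^+ 2 * (X * Y) - B1 ^+ 2 * (Z * U)) ^+ 2)
  by ring.
by rewrite s11 s22 !mul1r subrr.
Qed.

(** * Critical angles of the volume *)

Section level_sets.
Context {R : realType} (p1 p2 q1 q2 : R).
Hypotheses (hp : `|p1| != `|p2|) (hq : `|q1| != `|q2|)
    (hpq : Num.max (p1 ^+ 2) (p2 ^+ 2) + Num.max (q1 ^+ 2) (q2 ^+ 2) < 1).

Let tmin := asin (Num.max `|q1| `|q2|).
Let tmax := acos (Num.max `|p1| `|p2|).

Let pq_lt1 p q : p = p1 \/ p = p2 -> q = q1 \/ q = q2 -> p ^+ 2 + q ^+ 2 < 1.
Proof.
move=> hp' hq'; apply: le_lt_trans hpq; apply: lerD; rewrite le_max.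
  by case: hp' => ->; rewrite lexx ?orbT.
by case: hq' => ->; rewrite lexx ?orbT.
Qed.

Let norm_lt1 (x : R) : x ^+ 2 < 1 -> `|x| < 1.
Proof. by move=> h; rewrite -(@ltr_pXn2r _ 2) ?nnegrE // real_normK ?num_real // expr1n. Qed.

Let p_lt1 p : p = p1 \/ p = p2 -> `|p| < 1.
Proof.
move=> h; apply: norm_lt1; have := pq_lt1 p q1 h (or_introl erefl).
by have := sqr_ge0 q1; lra.
Qed.

Let q_lt1 q : q = q1 \/ q = q2 -> `|q| < 1.
Proof.
move=> h; apply: norm_lt1; have := pq_lt1 p1 q (or_introl erefl) h.
by have := sqr_ge0 p1; lra.
Qed.

(** In the open interval all radicands in the vertices are positive, so that the diagonal tetrahedra
    are nondegenerate and the angles differentiable. *)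
Lemma interior_angle t : tmin < t < tmax ->
  [/\ 0 < t < pi / 2, `|p1| < cos t, `|p2| < cos t, `|q1| < sin t & `|q2| < sin t].
Proof.
move=> /andP[t1 t2].
have pi0 := pi_gt0 R.
have mp0 : 0 <= Num.max `|p1| `|p2| by rewrite le_max normr_ge0.
have mq0 : 0 <= Num.max `|q1| `|q2| by rewrite le_max normr_ge0.
have mp1 : Num.max `|p1| `|p2| < 1.
  by rewrite gt_max !p_lt1 //; [right|left].
have mq1 : Num.max `|q1| `|q2| < 1.
  by rewrite gt_max !q_lt1 //; [right|left].
have mpi : -1 <= Num.max `|p1| `|p2| <= 1 by apply/andP; split; lra.
have mqi : -1 <= Num.max `|q1| `|q2| <= 1 by apply/andP; split; lra.
have ta : - (pi / 2) <= tmin by apply: asin_geNpi2.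
have tb : tmin <= pi / 2 by apply: asin_lepi2.
have tc : 0 <= tmax by apply: acos_ge0.
have td : tmax <= pi by apply: acos_lepi.
have a0 : 0 <= tmin.
  rewrite leNgt; apply/negP => h.
  have : sin tmin < sin 0.
    by rewrite ltr_sin // in_itv /=; apply/andP; split; lra.
  by rewrite sin0 asinK ?in_itv // ltNge mq0.
have b0 : tmax <= pi / 2.
  rewrite leNgt; apply/negP => h.
  have : cos tmax < cos (pi / 2).
    by rewrite ltr_cos // in_itv /=; apply/andP; split; lra.
  by rewrite cos_pihalf acosK ?in_itv // ltNge mp0.
have tpi : 0 < t < pi / 2 by apply/andP; split; lra.
have sq : Num.max `|q1| `|q2| < sin t.
  rewrite -[X in X < _](asinK _) ?in_itv // -/tmin ltr_sin // in_itv /=;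
  apply/andP; split; lra.
have cq : Num.max `|p1| `|p2| < cos t.
  rewrite -[X in X < _](acosK _) ?in_itv // -/tmax ltr_cos // in_itv /=;
  apply/andP; split; lra.
by move: sq cq; rewrite !gt_max => /andP[? ?] /andP[? ?].
Qed.

Let angle_combination (s1 s2 u1 u2 : R) (t : R) : R :=
  s1 * u1 * axis_angles p1 q1 t + s2 * u1 * axis_angles p2 q1 t
  + s1 * u2 * axis_angles p1 q2 t + s2 * u2 * axis_angles p2 q2 t.

Let countable_angle_combination (s1 s2 u1 u2 v : R) :
  s1 ^+ 2 = 1 -> s2 ^+ 2 = 1 -> u1 ^+ 2 = 1 -> u2 ^+ 2 = 1 ->
  countable [set t | tmin < t < tmax /\ angle_combination s1 s2 u1 u2 t = v].
Proof.
move=> s11 s22 u11 u22.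
(* For [w = cos t ^+ 2] one has [sin t ^+ 2 - q ^+ 2 = r q ^+ 2 - w], the shape required by
   [critical_poly]. *)
pose r (q : R) := Num.sqrt (1 - q ^+ 2).
have rr q : q = q1 \/ q = q2 -> r q ^+ 2 = 1 - q ^+ 2.
  move=> hq'; rewrite sqr_sqrtr // ltW //.
  by have := pq_lt1 p1 q (or_introl erefl) hq'; have := sqr_ge0 p1; lra.
have pr p q : p = p1 \/ p = p2 -> q = q1 \/ q = q2 -> `|p| < r q.
  move=> hp' hq'; rewrite -(@ltr_pXn2r _ 2) ?nnegrE ?sqrtr_ge0 // real_normK ?num_real //.
  by rewrite rr //; have := pq_lt1 p q hp' hq'; lra.
have r12 : r q1 != r q2.
  apply: contraNneq hq => h.
  rewrite -(@eqrXn2 _ 2) // !real_normK ?num_real //.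
  have := rr q1 (or_introl erefl); rewrite h (rr q2 (or_intror erefl)).
  by move=> e; apply/eqP; lra.
have [s hs] := poly_roots_seq _ (critical_poly_neq0 p1 p2 (r q1) (r q2) hp r12
  (pr _ _ (or_introl erefl) (or_introl erefl)) (pr _ _ (or_introl erefl) (or_intror erefl))
  (pr _ _ (or_intror erefl) (or_introl erefl)) (pr _ _ (or_intror erefl) (or_intror erefl))).
pose dang (p q t : R) := - (2 * sin t * (cos t ^+ 2 - p * Num.sqrt (1 - q ^+ 2))
        / (cos t * (Num.sqrt (cos t ^+ 2 - p ^+ 2) * Num.sqrt (sin t ^+ 2 - q ^+ 2)))).
apply: (@countable_level_set _ _ (fun t =>
  s1 * u1 * dang p1 q1 t + s2 * u1 * dang p2 q1 t
  + s1 * u2 * dang p1 q2 t + s2 * u2 * dang p2 q2 t) (fun t => cos t ^+ 2) s).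
- move=> t /interior_angle[_ c1 c2 c3 c4].
  have term k p q : `|p| < cos t -> `|q| < sin t ->
      is_derive t 1 (fun t => k * axis_angles p q t) (k * dang p q t).
    move=> hc hs'; apply: is_derive_eq
      (deriv_mul _ _ _ _ _ (deriv_cst k t) (is_derive_axis_angles p q t hc hs')) _.
    by rewrite mul0r add0r.
  apply: deriv_add (term _ _ _ c2 c4).
  apply: deriv_add (term _ _ _ c1 c4).
  exact: deriv_add (term _ _ _ c1 c3) (term _ _ _ c2 c3).
- move=> t /interior_angle[/andP[t0 tpi] c1 c2 c3 c4] e; apply: hs.
  have c0 : 0 < cos t := le_lt_trans (normr_ge0 p1) c1.
  have s0 : 0 < sin t := le_lt_trans (normr_ge0 q1) c3.
  have K p : `|p| < cos t -> 0 < cos t ^+ 2 - p ^+ 2 by move/sqr_lt_norm; rewrite subr_gt0.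
  have L q : `|q| < sin t -> 0 < sin t ^+ 2 - q ^+ 2 by move/sqr_lt_norm; rewrite subr_gt0.
  have sK p : `|p| < cos t -> Num.sqrt (cos t ^+ 2 - p ^+ 2) != 0.
    by move=> h; rewrite gt_eqF // sqrtr_gt0 K.
  have sL q : `|q| < sin t -> Num.sqrt (sin t ^+ 2 - q ^+ 2) != 0.
    by move=> h; rewrite gt_eqF // sqrtr_gt0 L.
  apply: (critical_poly_root p1 p2 (r q1) (r q2) (cos t ^+ 2)
    (Num.sqrt (cos t ^+ 2 - p1 ^+ 2)) (Num.sqrt (cos t ^+ 2 - p2 ^+ 2))
    (Num.sqrt (sin t ^+ 2 - q1 ^+ 2)) (Num.sqrt (sin t ^+ 2 - q2 ^+ 2)) s1 s2 u1 u2);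
    rewrite ?sK ?sL //.
  + by rewrite sqr_sqrtr // ltW // K.
  + by rewrite sqr_sqrtr // ltW // K.
  + by rewrite sqr_sqrtr ?rr; [rewrite sin2cos2; ring|left|rewrite ltW // L].
  + by rewrite sqr_sqrtr ?rr; [rewrite sin2cos2; ring|right|rewrite ltW // L].
  (* The common factor of the four derivatives; what remains of their sum is the equation treated by
     [critical_poly_root]. *)
  have kn : - (2 * sin t / cos t) != 0.
    by rewrite oppr_eq0 !mulf_neq0 ?invr_eq0 ?pnatr_eq0 // gt_eqF.
  apply: (mulfI kn); rewrite mulr0 -e /dang -!/(r _).
  move: (sK _ c1) (sK _ c2) (sL _ c3) (sL _ c4).
  move: (Num.sqrt (cos t ^+ 2 - p1 ^+ 2)) (Num.sqrt (cos t ^+ 2 - p2 ^+ 2))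
    (Num.sqrt (sin t ^+ 2 - q1 ^+ 2)) (Num.sqrt (sin t ^+ 2 - q2 ^+ 2)) (r q1) (r q2).
  have : cos t != 0 by rewrite gt_eqF.
  move: (cos t) (sin t) => c si cn A1 A2 B1 B2 x1 x2 A10 A20 B10 B20.
  by field; rewrite cn A10 A20 B10 B20.
- move=> x y tx xy ty.
  have ix : tmin < x < tmax by rewrite tx (lt_trans xy ty).
  have iy : tmin < y < tmax by rewrite ty (lt_trans tx xy).
  have [/andP[x0 xpi] _ _ _ _] := interior_angle x ix.
  have [/andP[y0 ypi] cy _ _ _] := interior_angle y iy.
  have pi0 := pi_gt0 R.
  have cxy : cos y < cos x.
    by rewrite ltr_cos // in_itv /=; apply/andP; split; lra.
  have cy0 : 0 <= cos y := le_trans (normr_ge0 p1) (ltW cy).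
  by rewrite ltr_pXn2r // nnegrE // (le_trans cy0) // ltW.
Qed.

(** The alternating signs are absorbed by negating [d2] and [e2]. The constant parts of the four
    terms add up to [C], so the sum is an affine function of an angle combination with slope
    [k != 0]. *)
Lemma countable_axis_sum (d1 d2 e1 e2 v : R) :
  is_sign d1 -> is_sign d2 -> is_sign e1 -> is_sign e2 ->
  countable [set t | tmin < t < tmax /\ axis_sum p1 p2 q1 q2 t d1 d2 e1 e2 = v].
Proof.
move=> h1 h2 h3 h4.
have sq (x : R) : is_sign x -> x ^+ 2 = 1 by case=> ->; rewrite ?sqrrN expr1n.
pose m := ball_measure [set: 'rV[R]_4].
pose k := - (m / (2 * pi)); pose C := m * (d1 - d2) * (e1 - e2).
have E t : axis_sum p1 p2 q1 q2 t d1 d2 e1 e2 =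
    C + k * angle_combination d1 (- d2) e1 (- e2) t.
  rewrite /axis_sum /angle_combination !big_bool /= expr0 expr1 /k /C -/m.
  move: (axis_angles _ _ _) (axis_angles _ _ _) (axis_angles _ _ _) (axis_angles _ _ _)
    => x1 x2 x3 x4.
  have := pi_gt0 R; move: (pi : R) (m) => p m' p0.
  by field; rewrite gt_eqF.
have k0 : k != 0.
  by rewrite oppr_eq0 mulf_neq0 ?invr_eq0 ?mulf_neq0 ?gt_eqF ?pi_gt0 ?ball_measureT_gt0.
apply: sub_countable (countable_angle_combination d1 (- d2) e1 (- e2) ((v - C) / k) _ _ _ _);
  rewrite ?sqrrN ?sq //.
apply: subset_card_le => t /= [ht ev]; split => //.
by rewrite -ev E [C + _]addrC addrK mulrAC divff ?mul1r.
Qed.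

End level_sets.

(** * Cardinality of a segment *)

Lemma signP {R : realType} (x : R) : is_sign x -> exists b : bool, x = (-1) ^+ b.
Proof. by case=> ->; [exists false|exists true]. Qed.

Lemma is_sign_exp {R : realType} (b : bool) : is_sign ((-1) ^+ b : R).
Proof. by case: b; [right|left]. Qed.

(* The representative real volume is determined up to the periods in the definition and
   those coming from [sphere_total]: [v] lists the countably many possible levels. *)
Lemma countable_volume_fiber {R : realType} (p1 p2 q1 q2 d1 d2 e1 e2 y0 : R)
    (hp : `|p1| != `|p2|) (hq : `|q1| != `|q2|)
    (hpq : Num.max (p1 ^+ 2) (p2 ^+ 2) + Num.max (q1 ^+ 2) (q2 ^+ 2) < 1) :
  is_sign d1 -> is_sign d2 -> is_sign e1 -> is_sign e2 ->
  countable [set t |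
    asin (Num.max `|q1| `|q2|) <= t <= acos (Num.max `|p1| `|p2|) /\
    class_oriented_volume (\pi_(octahedron_class R)%qT
      (flexible_octahedron p1 p2 q1 q2 t d1 d2 e1 e2)) =
    \pi_({ideal_quot @volume_periods R})%qT y0].
Proof.
move=> h1 h2 h3 h4; set a := asin _; set b := acos _.
pose v (n : bool * int * int) : R :=
  (-1) ^+ n.1.1 * (n.2%:~R * sphere_total - n.1.2%:~R * (2 * pi ^+ 2) - y0).
pose F n := [set t | a < t < b /\ axis_sum p1 p2 q1 q2 t d1 d2 e1 e2 = v n].
pose G n := if n is Some n then F n else [set a; b].
apply: (@sub_countable _ _ _ (\bigcup_n G n)); last first.
  apply: bigcup_countable => // -[n|] _; first exact: countable_axis_sum.
  by apply: finite_set_countable; exact: finite_set2.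
apply: subset_card_le => t /= [/andP[ta tb] vt].
have [->|ta'] := eqVneq t a; first by exists None => //; left.
have [->|tb'] := eqVneq t b; first by exists None => //; right.
have tab : a < t < b by rewrite !lt_neqAle ta tb tb' eq_sym ta'.
have [_ c1 c2 c3 c4] := interior_angle p1 p2 q1 q2 hpq t tab.
have [y [k [vy ks hk]]] := flexible_class_volume p1 p2 q1 q2 t d1 d2 e1 e2
  c1 c2 c3 c4 h1 h2 h3 h4 _ erefl.
have [c kE] := signP k ks.
have : y - y0 \in @volume_periods R.
  by rewrite Quotient.idealrBE; apply/eqP; rewrite -vy.
rewrite inE => /intrP[i hi]; move: hk; rewrite inE => /intrP[j hj].
exists (Some (c, i, j)) => //; split => //.
have pin : 2 * pi ^+ 2 != 0 :> R by rewrite mulf_neq0 ?expf_neq0 ?pnatr_eq0 // gt_eqF // pi_gt0.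
have {}hi : y = i%:~R * (2 * pi ^+ 2) + y0 by rewrite -hi divfK // subrK.
have {}hj : k * axis_sum p1 p2 q1 q2 t d1 d2 e1 e2 = j%:~R * sphere_total - y.
  by rewrite -hj divfK ?sphere_total_neq0 // addrAC subrr add0r.
rewrite /v /= -kE -addrA -opprD -hi -hj mulrA -expr2.
by case: ks => ->; rewrite ?sqrrN expr1n mul1r.
Qed.

Theorem corollary6p4 (R : realType) (p1 p2 q1 q2 : R)
    (hp : `|p1| != `|p2|) (hq : `|q1| != `|q2|)
    (hpq : Num.max (p1 ^+ 2) (p2 ^+ 2) + Num.max (q1 ^+ 2) (q2 ^+ 2) < 1)
    (S : set (octahedron_class R))
    (hS : is_segment (configuration_curve p1 p2 q1 q2) S) :
  exists x y : octahedron_class R,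
    [/\ S x, S y & class_oriented_volume x <> class_oriented_volume y].
Proof.
have [SG [gamma [_ gI SE]]] := hS.
apply: contrapT => const.
have gS t : t \in `[0, 1] -> S (gamma t) by move=> t01; rewrite SE; exists t.
have i0 : (0 : R) \in `[0, 1] by rewrite in_itv /= lexx ler01.
pose y0 := repr (class_oriented_volume (gamma 0)).
have cst t : t \in `[0, 1] ->
    class_oriented_volume (gamma t) = \pi_({ideal_quot @volume_periods R})%qT y0.
  move=> t01; rewrite /y0 reprK; apply: contrapT => ne; apply: const.
  by exists (gamma t), (gamma 0); split; [exact: gS|exact: gS|].
pose flex (n : bool * bool * bool * bool) theta : octahedron_class R :=
  \pi_(octahedron_class R)%qT (flexible_octahedron p1 p2 q1 q2 theta
    ((-1) ^+ n.1.1.1) ((-1) ^+ n.1.1.2) ((-1) ^+ n.1.2) ((-1) ^+ n.2)).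
(* The parameters are sorted by sign pattern. Covering the segment by the sixteen patterns replaces
   following the signs along it. *)
pose T n := [set t : R | t \in `[0, 1] /\ exists theta,
  asin (Num.max `|q1| `|q2|) <= theta <= acos (Num.max `|p1| `|p2|) /\ gamma t = flex n theta].
have cT n : countable (T n).
  have := countable_volume_fiber p1 p2 q1 q2 _ _ _ _ y0 hp hq hpq
    (is_sign_exp n.1.1.1) (is_sign_exp n.1.1.2) (is_sign_exp n.1.2) (is_sign_exp n.2).
  move=> /countable_injP[N NI].
  have th t : exists theta, T n t ->
      asin (Num.max `|q1| `|q2|) <= theta <= acos (Num.max `|p1| `|p2|) /\ gamma t = flex n theta.
    have [[_ [theta h]]|nT] := pselect (T n t); first by exists theta.
    by exists 0.
  have [f hf] := choice th.
  (* Within one sign pattern the angle determines the octahedron, so injectivity of [gamma] carries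
     countability from angles back to parameters. *)
  apply/countable_injP; exists (N \o f) => t u /set_mem Tt /set_mem Tu /= Nfe.
  have [ft gt] := hf t Tt; have [fu gu] := hf u Tu.
  apply: gI; [exact: Tt.1|exact: Tu.1|].
  rewrite gt gu; congr (flex n).
  apply: NI => //; rewrite inE; split => //;
    [rewrite -/(flex n (f t)) -gt|rewrite -/(flex n (f u)) -gu]; apply: cst.
    exact: Tt.1.
  exact: Tu.1.
(* Sixteen countable sets would cover the unit interval, whose measure is [1]. *)
have : countable (`[0, 1]%classic : set R).
  apply: (@sub_countable _ _ _ (\bigcup_n T n)); last by apply: bigcup_countable.
  apply: subset_card_le => t /= t01.
  have [theta [d1 [d2 [e1 [e2 [ht [hd1 hd2] [he1 he2] gt]]]]]] := SG _ (gS t t01).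
  have [b1 E1] := signP _ hd1; have [b2 E2] := signP _ hd2.
  have [b3 E3] := signP _ he1; have [b4 E4] := signP _ he2.
  exists (b1, b2, b3, b4) => //; split => //; exists theta; split => //.
  by rewrite gt E1 E2 E3 E4.
move=> /countable_lebesgue_measure0; rewrite lebesgue_measure_itv /= lte_fin ltr01.
by rewrite oppr0 adde0 => /eqP; rewrite eqe oner_eq0.
Qed.
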